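(* Let $V\subset\mathbb{C}^4$ be a generic complex affine plane, let $V^\times=V\cap(\mathbb{C}^\times)^4$, and let $\mathcal{B}:V^\times\to(\mathbb{R}P^1)^4$ be its rolled coamoeba map. Then the set $\mathcal{B}_Z\subset(\mathbb{R}P^1)^4$ of critical values of $\mathcal{B}$ is homeomorphic to $\mathbb{R}P^2$ blown up at four points.
   Context: Notation: $\mathbb{C}^\times=\mathbb{C}\setminus\{0\}$. A complex affine plane in $\mathbb{C}^4$ is a complex affine subspace of complex dimension 2. ''Generic'' means: outside a proper real-algebraic subset of the space of all complex affine planes in $\mathbb{C}^4$. The map $2Arg:(\mathbb{C}^\times)^4\to(\mathbb{R}P^1)^4$ is defined coordinatewise by $2arg(z)=[\mathrm{Re}(z):\mathrm{Im}(z)]\in\mathbb{R}P^1$; equivalently, $2arg(z)$ is the real line in $\mathbb{C}$ through $0$ and $z$, where $\mathbb{R}P^1$ is the set of real lines through the origin in $\mathbb{C}$. The rolled coamoeba map $\mathcal{B}$ is the restriction of $2Arg$ to $V^\times$. It is a smooth map between real 4-dimensional manifolds; its critical points are the points where its real differential is not surjective. $Z\subset V^\times$ denotes the set of critical points and $\mathcal{B}_Z=\mathcal{B}(Z)$ the set of critical values, with the subspace topology. Blow-up means real blow-up at distinct points; topologically, $\mathbb{R}P^2$ blown up at $n$ points is the connected sum of $n+1$ copies of $\mathbb{R}P^2$. *)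

(* Defs.v *)
(* The reals are an arbitrary [R : realType]; the complex numbers are [R[i]]. *)
From HB Require Import structures.
From mathcomp Require Import all_boot all_order all_algebra generic_quotient.
From mathcomp Require Import all_classical all_reals all_analysis.
From mathcomp Require Import complex.
From mathcomp Require mpoly.

Set Implicit Arguments.
Unset Strict Implicit.
Unset Printing Implicit Defensive.

Import Order.TTheory GRing.Theory Num.Theory.
Import numFieldNormedType.Exports.

Local Open Scope classical_set_scope.
Local Open Scope ring_scope.
Local Open Scope quotient_scope.

Definition homeomorphic (X Y : topologicalType) : Prop :=
  exists (f : X -> Y) (g : Y -> X),
    [/\ continuous f, continuous g, cancel f g & cancel g f].

Section RealProjectiveSpace.
Variables (R : realType) (n : nat).

Local Notation nonzero_vec := (set_type [set v : 'rV[R]_n.+1 | v != 0]).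

Definition same_line (u v : nonzero_vec) : bool := (\val u == \val v)%MS.

Lemma same_line_equiv : equiv_class_of same_line.
Proof.
split=> [u|u v|v u w].
- by rewrite /same_line submx_refl.
- by rewrite /same_line andbC.
- rewrite /same_line => /andP[uv vu] /andP[vw wv].
  by rewrite (submx_trans uv vw) (submx_trans wv vu).
Qed.

Canonical same_line_equivRel := EquivRelPack same_line_equiv.

(* RP^n with the quotient topology of R^(n+1) minus the origin. *)
Definition RP : Type := quotient_topology {eq_quot same_line}.

HB.instance Definition _ := Topological.copy RP
  (quotient_topology {eq_quot same_line}).
HB.instance Definition _ := Quotient.copy RP {eq_quot same_line}.

Lemma const_mx1_neq0 :
  (const_mx 1 : 'rV[R]_n.+1) \in [set v : 'rV[R]_n.+1 | v != 0].
Proof.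
rewrite inE /=; apply/eqP => /matrixP /(_ ord0 ord0).
by rewrite !mxE => /eqP; rewrite oner_eq0.
Qed.

(* The line [v_0 : ... : v_n]; the value at [v = 0] is irrelevant. *)
Definition RPclass (v : 'rV[R]_n.+1) : RP :=
  \pi_RP (insubd (SigSub const_mx1_neq0 : nonzero_vec) v).

(* Homogeneous coordinates, determined up to a nonzero scalar. *)
Definition hcoord (x : RP) : 'rV[R]_n.+1 := \val (repr x).

End RealProjectiveSpace.

Section RolledCoamoeba.
Variable R : realType.
Local Notation C := R[i].

Definition twoarg (z : C) : RP R 1 :=
  RPclass (\row_(j < 2) if j == ord0 then complex.Re z else complex.Im z).

Definition TwoArg (z : 'rV[C]_4) : {ptws 'I_4 -> RP R 1} :=
  fun i => twoarg (z ord0 i).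

(* The two standard affine charts of RP^1: [chart false] is [x : y] |-> y / x
   and [chart true] is [x : y] |-> x / y. *)
Definition chart (b : bool) (l : RP R 1) : R :=
  if b then hcoord l ord0 ord0 / hcoord l ord0 ord_max
  else hcoord l ord0 ord_max / hcoord l ord0 ord0.

(* A chart whose domain contains [l]. *)
Definition chart_at (l : RP R 1) : bool := hcoord l ord0 ord0 == 0.

Definition plane_of (a : 'rV[C]_4) (M : 'M[C]_(2, 4)) : set 'rV[C]_4 :=
  [set a + s *m M | s in [set: 'rV[C]_2]].

Definition affine_plane (V : set 'rV[C]_4) : Prop :=
  exists (a : 'rV[C]_4) (M : 'M[C]_(2, 4)), row_free M /\ V = plane_of a M.

Definition direction (V : set 'rV[C]_4) : set 'rV[C]_4 :=
  [set u | exists z w, [/\ V z, V w & u = w - z]].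

Definition torus_part (V : set 'rV[C]_4) : set 'rV[C]_4 :=
  V `&` [set z | forall i, z ord0 i != 0].

(* The real differential at [z] of the rolled coamoeba map, read in the product
   of affine charts of RP^1 around the point [TwoArg z] and applied to the
   tangent vector [u], as the velocity of the image of the curve z + t u.  The
   tangent space of V^x at [z] is [direction V]. *)
Definition dTwoArg (z u : 'rV[C]_4) : 'rV[R]_4 :=
  \row_i derive1 (fun t : R =>
    chart (chart_at (TwoArg z i)) (TwoArg (z + (real_complex R t) *: u) i)) 0.

Definition critical_points (V : set 'rV[C]_4) : set 'rV[C]_4 :=
  [set z | torus_part V z /\ ~ set_surj (direction V) setT (dTwoArg z)].

Definition critical_values (V : set 'rV[C]_4) : set {ptws 'I_4 -> RP R 1} :=
  TwoArg @` critical_points V.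

Definition real_coords m n (A : 'M[C]_(m, n)) : 'rV[R]_(m * n + m * n) :=
  row_mx (mxvec (map_mx (@complex.Re R) A)) (mxvec (map_mx (@complex.Im R) A)).

(* The space of affine planes is the quotient of the space of pairs [(a, M)]
   with [M] of rank 2 by the group of affine reparametrizations of C^2.  A set
   of affine planes is real algebraic when its preimage is cut out by real
   polynomials in the real and imaginary parts of the entries of [a] and [M]. *)
Definition real_algebraic (E : set (set 'rV[C]_4)) : Prop :=
  E `<=` affine_plane /\
  exists S : set (mpoly.mpoly (3 * 4 + 3 * 4) R),
    forall (a : 'rV[C]_4) (M : 'M[C]_(2, 4)), row_free M ->
      E (plane_of a M) <->
      forall p, S p ->
        mpoly.meval (fun k => real_coords (col_mx a M) ord0 k) p = 0.

End RolledCoamoeba.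

Section BlowUp.
Variable R : realType.

(* Lines of RP^2 are given by points of the dual projective plane. *)
Definition on_line (x l : RP R 2) : bool := hcoord x *m (hcoord l)^T == 0.

(* The real blow-up of RP^2 at the points [p i], assumed distinct: the pairs of
   a point [x] and a family of lines [l i], with [l i] passing through [p i] and
   [x].  The line [l i] is determined by [x] unless [x = p i], where it ranges
   over the pencil of lines through [p i] (the exceptional curve). *)
Definition blowup (k : nat) (p : 'I_k -> RP R 2) :
    set (RP R 2 * {ptws 'I_k -> RP R 2})%type :=
  [set xl | forall i, on_line (p i) (xl.2 i) && on_line xl.1 (xl.2 i)].

(* The homeomorphism type of the blow-up at [k] distinct points does not depend
   on these points. *)
Definition is_RP2_blown_up_at (k : nat) (X : topologicalType) : Prop :=
  exists p : 'I_k -> RP R 2, injective p /\ homeomorphic X (set_type (blowup p)).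

End BlowUp.

(* Main.v *)
Require Import Defs.
From mathcomp Require Import all_boot all_order all_algebra generic_quotient.
From mathcomp Require Import all_classical all_reals all_analysis.
From mathcomp Require Import complex.
From mathcomp Require Import ring lra.
From mathcomp Require mpoly.

(** Why the theorem holds.

    A generic plane has equations [\sum_i k_i z_i = 0] and
    [\sum_i k_i w_i z_i = 1] with all [k_i] nonzero, so the covectors
    vanishing on its direction are the [mu] with [mu_i = k_i (t - w_i r)],
    for [r] and [t] complex.  The differential of the rolled coamoeba map at
    [z] sends [u] to the numbers [Im (u_i / z_i)], up to nonzero real factors.
    It is therefore not surjective exactly when such a nonzero [mu] has all
    products [mu_i z_i] real.  Then [\sum_i mu_i z_i = - r] is real.

    So let [theta_i] be the real line spanned by [e_i].  If [theta] is a
    critical value, then [Im (e_i k_i (t - w_i r)) = 0] for all [i], for some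
    nonzero pair [(r, t)] of a real and a complex number, that is, for a point
    of RP^2.  In [(r, t)], this equation is that of a line of RP^2 through the
    point [p_i = [1 : w_i]], and [theta_i] parametrizes the pencil of lines
    through [p_i].  Thus a critical value is a choice of one line in each of
    four pencils such that the four lines are concurrent.  Conversely, four
    concurrent lines come from a critical point as soon as one can solve
    [z_i = x_i e_i] in the plane with all [x_i] real and nonzero.  Up to a real
    factor, this means [\sum_i k_i e_i x_i = 0] and
    [Im (\sum_i k_i w_i e_i x_i) = 0], with [x] off five hyperplanes.  These
    three real equations have rank at most two because the lines are
    concurrent, and their solutions are not contained in one of the hyperplanes
    when no three of the [w_i] are collinear and all four are not concyclic
    ([critical_values_normal_plane]).

    The blow-up of RP^2 at the [p_i] consists of a point and four lines
    through it, one in each pencil.  It maps to the critical values by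
    forgetting the point.  This is injective because the point common to the
    four lines is unique: otherwise all four lines would be equal and contain
    all the [p_i].  Both spaces are images of the compact space
    [incidence_graph] under continuous injections into Hausdorff spaces, hence
    they are homeomorphic ([critical_values_normal_plane_homeomorphic]).

    Finally, a plane given by a point and a basis of its direction can be put
    in the above form when a certain real polynomial, [discriminant], does not
    vanish.  The planes all of whose parametrizations have zero discriminant
    form a real algebraic set ([degenerate_algebraic]), which is proper by an
    explicit example ([sample_discriminant]). *)

Set Implicit Arguments.
Unset Strict Implicit.
Unset Printing Implicit Defensive.

Import Order.TTheory GRing.Theory Num.Theory.
Import numFieldNormedType.Exports.

Local Open Scope classical_set_scope.
Local Open Scope ring_scope.
Local Open Scope quotient_scope.

(** * Compact images and product topologies *)

Lemma homeomorphic_sym (X Y : topologicalType) :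
  homeomorphic X Y -> homeomorphic Y X.
Proof. by move=> [f [g [cf cg fK gK]]]; exists g, f; split. Qed.

Lemma homeomorphic_trans (X Y Z : topologicalType) :
  homeomorphic X Y -> homeomorphic Y Z -> homeomorphic X Z.
Proof.
move=> [f [f' [cf cf' fK f'K]]] [g [g' [cg cg' gK g'K]]].
exists (g \o f), (f' \o g'); split.
- by move=> x; apply: continuous_comp; [exact: cf|exact: cg].
- by move=> x; apply: continuous_comp; [exact: cg'|exact: cf'].
- exact: can_comp.
- exact: can_comp.
Qed.

(** A continuous injection from a compact set to a Hausdorff space is closed:
    it sends the closed, hence compact, subsets of [A] to compact, hence
    closed, sets. *)
Lemma compact_image_homeomorphic (T U : topologicalType) (A : set T)
    (f : T -> U) :
  hausdorff_space U -> compact A -> continuous f -> {in A &, injective f} ->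
  homeomorphic (set_type A) (set_type (f @` A)).
Proof.
move=> hU cA cf fI.
have fP (a : A) : f (\val a) \in f @` A.
  by apply/mem_set; exists (\val a) => //; exact/set_mem/(valP a).
have gP (b : f @` A) : exists a : A, f (\val a) = \val b.
  have /set_mem[a Aa ab] := valP b.
  by exists (SigSub (mem_set Aa : a \in A)).
pose F (a : A) : f @` A := SigSub (fP a).
pose G (b : f @` A) : A := sval (cid (gP b)).
have GP b : f (\val (G b)) = \val b by rewrite /G; case: cid.
exists F, G; split.
- apply: continuous_comp_initial => a.
  apply: (@continuous_comp _ _ _ set_val f a); last exact: cf.
  exact: initial_continuous.
- apply/continuous_closedP => C cC.
  have [D cD CD] : exists2 D : set T, closed D & C = set_val @^-1` D.
    have [W oW WC] := closed_openC cC.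
    exists (~` W); first exact: open_closedC.
    by rewrite -preimage_setC WC setCK.
  rewrite (_ : G @^-1` C = set_val @^-1` (f @` (A `&` D))).
    move: (@initial_continuous (f @` A) U set_val) => /continuous_closedP.
    apply; apply: compact_closed => //; apply: continuous_compact.
      exact: continuous_subspaceT.
    exact: compact_closedI.
  apply/seteqP; split=> b /=.
    rewrite CD /= => DG; exists (\val (G b)); last exact: GP.
    by split=> //; exact/set_mem/(valP (G b)).
  move=> [a [Aa Da] ab]; rewrite CD /=.
  suff -> : set_val (G b) = a by [].
  by apply: fI; [exact: (valP (G b))|exact: mem_set|rewrite ab; exact: GP].
- by move=> a; apply/val_inj/fI; rewrite ?GP//; exact: valP.
- by move=> b; apply/val_inj; exact: GP.
Qed.

Lemma ptws_continuous (T U : topologicalType) (I : Type) (f : T -> {ptws I -> U}) :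
  (forall i, continuous (fun t => f t i)) -> continuous f.
Proof.
move=> cf t; apply/cvg_sup => i.
exact: (@continuous_comp_initial _ _ _ (fun g : I -> U => g i) f (cf i) t).
Qed.

Lemma ptws_eval_continuous (U : topologicalType) (I : eqType) (i : I) :
  continuous (fun g : {ptws I -> U} => g i).
Proof. exact: (@proj_continuous I (fun=> U) i). Qed.

Lemma hausdorff_prod (T U : topologicalType) :
  hausdorff_space T -> hausdorff_space U -> hausdorff_space (T * U)%type.
Proof.
move=> hT hU [x y] [x' y'] xy; congr pair.
- apply: hT => A B Ax Bx.
  have nA : nbhs (x, y) (fst @^-1` A) by apply: (@cvg_fst _ _ (nbhs x) (nbhs y)).
  have nB : nbhs (x', y') (fst @^-1` B) by apply: (@cvg_fst _ _ (nbhs x') (nbhs y')).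
  by have [z [Az Bz]] := xy _ _ nA nB; exists z.1.
- apply: hU => A B Ay By.
  have nA : nbhs (x, y) (snd @^-1` A) by apply: (@cvg_snd _ _ (nbhs x) (nbhs y)).
  have nB : nbhs (x', y') (snd @^-1` B) by apply: (@cvg_snd _ _ (nbhs x') (nbhs y')).
  by have [z [Az Bz]] := xy _ _ nA nB; exists z.2.
Qed.

Lemma fst_continuous (T U : topologicalType) : continuous (@fst T U).
Proof. by move=> [x y]; exact: cvg_fst. Qed.

Lemma snd_continuous (T U : topologicalType) : continuous (@snd T U).
Proof. by move=> [x y]; exact: cvg_snd. Qed.

Lemma pair_continuous (T U V : topologicalType) (f : T -> U) (g : T -> V) :
  continuous f -> continuous g -> continuous (fun t => (f t, g t)).
Proof. by move=> cf cg t; apply: cvg_pair; [exact: cf|exact: cg]. Qed.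

Lemma snd_eval_continuous (T U V : topologicalType) (I : eqType) (h : U -> V) (i : I) :
  continuous h -> continuous (fun xg : T * {ptws I -> U} => h (xg.2 i)).
Proof.
move=> ch xg; apply: (@continuous_comp _ _ _ (fun xg : T * {ptws I -> U} => xg.2 i) h);
  last exact: ch.
apply: (@continuous_comp _ _ _ snd (fun g : {ptws I -> U} => g i)).
  exact: snd_continuous.
exact: ptws_eval_continuous.
Qed.

Lemma fiberwise_continuous (T U V : topologicalType) (I : eqType) (h : I -> U -> V) :
  (forall i, continuous (h i)) ->
  continuous (fun xg : T * {ptws I -> U} =>
    (xg.1, (fun i => h i (xg.2 i)) : {ptws I -> V})).
Proof.
move=> ch; apply: (@pair_continuous _ _ _ fst
  (fun xg : T * {ptws I -> U} => (fun i => h i (xg.2 i)) : {ptws I -> V})).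
  exact: fst_continuous.
by apply: ptws_continuous => i; exact: snd_eval_continuous.
Qed.

(** * Topology of real projective spaces *)

Section ProjectiveSpace.
Variables (R : realType) (n : nat).
Implicit Types (u v : 'rV[R]_n.+1) (x y : RP R n).

Local Notation nonzero_vec := (set_type [set v : 'rV[R]_n.+1 | v != 0]).
Local Notation to_nonzero := (insubd (SigSub (const_mx1_neq0 R n))).

Let val_to_nonzero v : v != 0 -> \val (to_nonzero v) = v.
Proof. by move=> v0; rewrite val_insubd mem_set. Qed.

Let piP (a b : nonzero_vec) :
  reflect (\pi_(RP R n) a = \pi_(RP R n) b) (same_line a b).
Proof. exact: (eqmodP (same_line_equivRel R n) a b). Qed.

Lemma hcoord_neq0 x : hcoord x != 0.
Proof. exact: (set_mem (valP (repr x))). Qed.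

Lemma hcoord_RPclass v : v != 0 ->
  exists2 c, c != 0 & hcoord (RPclass v) = c *: v.
Proof.
move=> v0; have : same_line (repr (RPclass v)) (to_nonzero v).
  by apply/piP; rewrite reprK.
rewrite /same_line (val_to_nonzero v0) => /andP[/sub_rVP[c hc] _].
exists c => //; apply/eqP => c0; have := hcoord_neq0 (RPclass v).
by rewrite /hcoord hc c0 scale0r eqxx.
Qed.

Lemma RPclass_hcoord x : RPclass (hcoord x) = x.
Proof.
rewrite -[RHS]reprK /RPclass; congr (\pi_(RP R n) _).
exact/val_inj/val_to_nonzero/hcoord_neq0.
Qed.

Lemma RPclassZ c v : c != 0 -> v != 0 -> RPclass (c *: v) = RPclass v.
Proof.
move=> c0 v0; apply/piP; rewrite /same_line !val_to_nonzero//.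
  by apply/eqmxP/eqmx_scale.
by rewrite scaler_eq0 negb_or c0.
Qed.

Lemma RPclass_inj u v : u != 0 -> v != 0 -> RPclass u = RPclass v ->
  exists2 c, c != 0 & u = c *: v.
Proof.
move=> u0 v0 /piP; rewrite /same_line !val_to_nonzero// => /andP[/sub_rVP[c uE] _].
by exists c => //; apply: contra_neq u0; rewrite uE => ->; rewrite scale0r.
Qed.

(** At [0] the class is a dummy value, so continuity can only be asked at
    nonzero vectors, which form an open set. *)
Lemma RPclass_continuous v : v != 0 -> {for v, continuous (@RPclass R n)}.
Proof.
move=> v0.
apply: (@continuous_comp _ nonzero_vec (RP R n) (fun w => to_nonzero w)
          (fun a => \pi_(RP R n) a)); last exact: pi_continuous.
move=> U [_ /= [[W oW <-]]] /=.
rewrite {1}/set_val /= /eqincl /= val_to_nonzero// => Wv /filterS; apply.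
  exact: (@fmap_filter _ _ (fun w => to_nonzero w) (nbhs v) (nbhs_filter v)).
have nbhsW : nbhs v W by apply: open_nbhs_nbhs.
have nbhs0 : nbhs v [set w : 'rV[R]_n.+1 | w != 0].
  apply: open_nbhs_nbhs; split=> //.
  suff -> : [set w : 'rV[R]_n.+1 | w != 0] = ~` [set 0].
    apply/closed_openC/accessible_closed_set1/hausdorff_accessible.
    exact: norm_hausdorff.
  by apply/seteqP; split=> w /= /eqP.
change (nbhs v [set w | W (\val (to_nonzero w))]).
apply: (@filterS2 _ _ (nbhs_filter v) _ _ _ _ nbhsW nbhs0) => w Ww w0.
by rewrite /= val_to_nonzero.
Qed.

(** The universal property of the quotient, phrased with homogeneous
    coordinates. *)
Lemma RP_continuous (Z : topologicalType) (f : 'rV[R]_n.+1 -> Z) :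
  (forall v, v != 0 -> {for v, continuous f}) ->
  (forall c v, c != 0 -> v != 0 -> f (c *: v) = f v) ->
  continuous (fun x => f (hcoord x)).
Proof.
move=> cf fZ; apply: (@repr_comp_continuous _ _ _ (fun a : nonzero_vec => f (\val a))).
  move=> a; apply: (@continuous_comp nonzero_vec 'rV[R]_n.+1 Z set_val f a).
    exact: initial_continuous.
  exact/cf/(set_mem (valP a)).
move=> a b /eqP/piP/andP[/sub_rVP[c ac] _]; rewrite ac fZ//.
  apply: contraTneq (set_mem (valP a)) => c0.
  by rewrite /= ac c0 scale0r eqxx.
exact: (set_mem (valP b)).
Qed.

End ProjectiveSpace.

Lemma sum_continuous_at (K : numFieldType) (V : normedModType K)
    (T : topologicalType) (I : Type) (r : seq I) (F : I -> T -> V) (t : T) :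
  (forall i, {for t, continuous (F i)}) ->
  {for t, continuous (fun s => \sum_(i <- r) F i s)}.
Proof.
move=> cF; apply: cvg_big; first exact: add_continuous.
by move=> i _; exact: cF.
Qed.

Section ProjectiveTopology.
Variables (R : realType) (n : nat).
Implicit Types (u v : 'rV[R]_n.+1) (x y : RP R n) (i j : 'I_n.+1).

Definition sqnorm v : R := \sum_i v ord0 i ^+ 2.

Lemma sqnorm_gt0 v : v != 0 -> 0 < sqnorm v.
Proof.
move=> v0; have s0 : 0 <= sqnorm v by apply: sumr_ge0 => i _; exact: sqr_ge0.
rewrite lt_neqAle s0 andbT eq_sym; apply: contraNneq v0 => /eqP.
rewrite psumr_eq0 => [/allP vi0|i _]; last exact: sqr_ge0.
apply/eqP/rowP => i; rewrite mxE; apply/eqP.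
by have := vi0 i (mem_index_enum i); rewrite /= sqrf_eq0.
Qed.

(** The matrix of the orthogonal projection onto the line [x].  Its entries are
    continuous functions on the whole of RP^n that separate points, which
    reduces topological questions on the quotient to the real line. *)
Definition proj_entry i j x : R :=
  hcoord x ord0 i * hcoord x ord0 j / sqnorm (hcoord x).

Lemma proj_entry_continuous i j : continuous (proj_entry i j).
Proof.
apply: (@RP_continuous R n R (fun v => v ord0 i * v ord0 j / sqnorm v)).
  move=> v v0; apply: continuousM.
    by apply: continuousM; exact: coord_continuous.
  apply: continuousV; first by rewrite gt_eqF// sqnorm_gt0.
  apply: sum_continuous_at => k.
  by apply: continuousM; exact: coord_continuous.
move=> c v c0 v0; have := sqnorm_gt0 v0.
have -> : sqnorm (c *: v) = c ^+ 2 * sqnorm v.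
  by rewrite /sqnorm mulr_sumr; apply: eq_bigr => k _; rewrite mxE exprMn.
by move=> s0; rewrite !mxE; field; rewrite c0 gt_eqF.
Qed.

Lemma proj_entry_inj x y : (forall i j, proj_entry i j x = proj_entry i j y) ->
  x = y.
Proof.
move=> xy; rewrite -(RPclass_hcoord x) -(RPclass_hcoord y).
have x0 := hcoord_neq0 x; have y0 := hcoord_neq0 y.
have /rV0Pn[j xj] := x0.
have sx := sqnorm_gt0 x0; have sy := sqnorm_gt0 y0.
have hxy : hcoord x = (sqnorm (hcoord x) / sqnorm (hcoord y) *
    hcoord y ord0 j / hcoord x ord0 j) *: hcoord y.
  apply/rowP => i; rewrite mxE; have := xy i j; rewrite /proj_entry.
  move/eqP; rewrite (eqr_div _ _ (lt0r_neq0 sx) (lt0r_neq0 sy)) => /eqP E.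
  apply: (mulIf xj); apply: (mulIf (lt0r_neq0 sy)).
  rewrite E; field.
  by rewrite xj gt_eqF.
rewrite [in LHS]hxy RPclassZ//; apply: contraNneq x0 => c0.
by rewrite hxy c0 scale0r.
Qed.

(** Distinct lines are separated by some real function [proj_entry i j]. *)
Lemma RP_hausdorff : hausdorff_space (RP R n).
Proof.
move=> x y xy; apply: proj_entry_inj => i j; apply: (@Rhausdorff R).
move=> A B Ax By.
have [z [Az Bz]] := xy _ _ (@proj_entry_continuous i j x A Ax)
  (@proj_entry_continuous i j y B By).
by exists (proj_entry i j z).
Qed.

(** RP^n is the image of the unit sphere. *)
Lemma RP_compact : compact [set: RP R n].
Proof.
pose S := [set v : 'rV[R]_n.+1 | `|v| = 1].
have -> : [set: RP R n] = @RPclass R n @` S.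
  apply/seteqP; split=> // x _; have x0 := hcoord_neq0 x.
  exists (`|hcoord x|^-1 *: hcoord x).
    by rewrite /S /= normrZ normfV normr_id mulVf ?normr_eq0.
  by rewrite RPclassZ ?RPclass_hcoord// invr_eq0 normr_eq0.
apply: continuous_compact.
  apply: continuous_in_subspaceT => v /set_mem; rewrite /S /= => v1.
  by apply: RPclass_continuous; rewrite -normr_eq0 v1 oner_eq0.
apply: bounded_closed_compact.
  by exists 1; split=> // M M1 v /= ->; exact: ltW.
have := @norm_continuous R 'rV[R]_n.+1 => /continuous_closedP.
by move=> /(_ [set 1] (@closed_eq _ 1)).
Qed.

(** If [P] and [Q] are the projections onto the lines spanned by [u] and [v],
    the trace of [P Q] is [(u . v)^2 / (|u|^2 |v|^2)], so orthogonality is the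
    vanishing of a continuous function of the two lines. *)
Lemma incidence_closed (T : topologicalType) (f g : T -> RP R n) :
  continuous f -> continuous g ->
  closed [set t | hcoord (f t) *m (hcoord (g t))^T == 0].
Proof.
move=> cf cg; pose h t := \sum_i \sum_j proj_entry i j (f t) * proj_entry i j (g t).
suff -> : [set t | hcoord (f t) *m (hcoord (g t))^T == 0] = h @^-1` [set 0].
  apply: preimage_closed; last exact: closed_eq.
  move=> t _; apply: sum_continuous_at => i.
  apply: sum_continuous_at => j.
  by apply: continuousM; apply: continuous_comp; [exact: cf| |exact: cg|];
    exact: proj_entry_continuous.
have hE t : h t = (hcoord (f t) *m (hcoord (g t))^T) ord0 ord0 ^+ 2 /
    (sqnorm (hcoord (f t)) * sqnorm (hcoord (g t))).
  have := sqnorm_gt0 (hcoord_neq0 (f t)); have := sqnorm_gt0 (hcoord_neq0 (g t)).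
  rewrite /h /proj_entry; move: (sqnorm _) (sqnorm _) => sg sf sg0 sf0.
  rewrite expr2 mxE !mulr_suml; apply: eq_bigr => i _; rewrite mulr_sumr mulr_suml.
  apply: eq_bigr => j _; rewrite !mxE.
  by field; rewrite !lt0r_neq0.
apply/seteqP; split=> t /=; rewrite hE.
  by move=> /eqP ->; rewrite mxE expr0n mul0r.
have fg0 := mulr_gt0 (sqnorm_gt0 (hcoord_neq0 (f t))) (sqnorm_gt0 (hcoord_neq0 (g t))).
move=> /eqP; rewrite mulf_eq0 invr_eq0 (gt_eqF fg0) orbF sqrf_eq0 => /eqP h0.
apply/eqP/matrixP => i j.
by rewrite !ord1 h0 mxE.
Qed.

End ProjectiveTopology.

(** Homogeneous coordinates whose 2 by 2 minors all vanish are proportional. *)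
Lemma RP_eq_minors (R : realType) n (x y : RP R n) :
  (forall i j, hcoord x ord0 i * hcoord y ord0 j = hcoord x ord0 j * hcoord y ord0 i) ->
  x = y.
Proof.
move=> E; have /rV0Pn[j yj] := hcoord_neq0 y.
have xE : hcoord x = (hcoord x ord0 j / hcoord y ord0 j) *: hcoord y.
  by apply/rowP => i; apply: (mulIf yj); rewrite mxE E; field.
rewrite -(RPclass_hcoord x) xE RPclassZ ?hcoord_neq0 ?RPclass_hcoord//.
by apply: contraNneq (hcoord_neq0 x) => c0; rewrite xE c0 scale0r.
Qed.

(** * The rolled argument and its differential *)

Lemma near_affine_neq0 (R : realType) (x x' : R) :
  x != 0 -> \forall t \near 0, x + t * x' != 0.
Proof.
move=> x0; have cx : {for 0, continuous (fun h : R => x + h * x')}.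
  by apply: continuousD; [exact: cst_continuous|apply: continuousM => //;
    exact: cst_continuous].
have : \forall y \near (x + 0 * x'), y != 0.
  rewrite mul0r addr0; apply: open_nbhs_nbhs; split=> //; exact: open_neq.
exact: cx.
Qed.

Lemma derive1_affine_quotient (R : realType) (f : R -> R) (p p' q q' : R) :
  q != 0 -> (\forall t \near 0, f t = (p + t * p') / (q + t * q')) ->
  derive1 f 0 = (p' * q - p * q') / q ^+ 2.
Proof.
move=> q0 fE; rewrite /derive1.
have f0 : f 0 = p / q by rewrite (nbhs_singleton fE) !mul0r !addr0.
have cq : {for 0, continuous (fun h : R => q + h * q')}.
  by apply: continuousD; [exact: cst_continuous|apply: continuousM => //;
    exact: cst_continuous].
have q'0 := near_affine_neq0 q' q0.
apply: cvg_lim => //.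
have : (fun h => (p' * q - p * q') / (q * (q + h * q'))) @ 0^' -->
    (p' * q - p * q') / q ^+ 2.
  have -> : (p' * q - p * q') / q ^+ 2 =
      (p' * q - p * q') / (q * (q + 0 * q')) by rewrite mul0r addr0 expr2.
  apply: cvg_within_filter; apply: cvgM; first exact: cvg_cst.
  apply: cvgV; first by rewrite mul0r addr0 mulf_neq0.
  by apply: cvgM; first exact: cvg_cst.
apply: cvg_trans; apply: near_eq_cvg.
near=> h; rewrite /= addr0 f0.
have h0 : h != 0 by near: h; exact: nbhs_dnbhs_neq.
have -> : f h = (p + h * p') / (q + h * q') by near: h; exact: nbhs_dnbhs fE.
have qh : q + h * q' != 0 by near: h; exact: nbhs_dnbhs q'0.
rewrite /GRing.scale /=; field.
by rewrite q0 qh h0.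
Unshelve. all: by end_near. Qed.

Section TwoArg.
Variable R : realType.
Local Notation C := R[i].
Local Notation Re := (@complex.Re R).
Local Notation Im := (@complex.Im R).
Local Notation "x %:C" := (real_complex R x) (format "x %:C").

Definition plane_vec (z : C) : 'rV[R]_2 :=
  \row_j (if j == ord0 then Re z else Im z).

Lemma plane_vec_eq0 z : (plane_vec z == 0) = (z == 0).
Proof.
apply/eqP/eqP => [/rowP z0|->]; last by apply/rowP => j; rewrite !mxE; case: ifP.
have := z0 ord0; have := z0 ord_max; rewrite !mxE /=.
by case: z {z0} => a b /= -> ->.
Qed.

Lemma plane_vecZ c z : plane_vec (c%:C * z) = c *: plane_vec z.
Proof.
by apply/rowP => j; rewrite !mxE; case: z => a b /=; case: ifP; rewrite mul0r ?subr0 ?addr0.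
Qed.

Lemma plane_vec_inj : injective plane_vec.
Proof.
move=> [a b] [c d] /rowP E; have := E ord0; have := E ord_max.
by rewrite !mxE /= => -> ->.
Qed.

(** A complex number spanning the real line [l], determined up to a nonzero
    real factor. *)
Definition dir (l : RP R 1) : C :=
  Complex (hcoord l ord0 ord0) (hcoord l ord0 ord_max).

Lemma plane_vec_dir l : plane_vec (dir l) = hcoord l.
Proof.
apply/rowP => j; rewrite mxE /=; case: ifP => [/eqP ->//|].
case: j => [[|[|//]]] //= j1 _; congr (hcoord l _ _); exact/val_inj.
Qed.

Lemma dir_neq0 l : dir l != 0.
Proof. by rewrite -plane_vec_eq0 plane_vec_dir hcoord_neq0. Qed.

Lemma twoarg_dir l : twoarg (dir l) = l.
Proof. by rewrite -[RHS]RPclass_hcoord -plane_vec_dir. Qed.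

Lemma twoargZ c z : c != 0 -> z != 0 -> twoarg (c%:C * z) = twoarg z.
Proof.
move=> c0 z0; rewrite -[LHS]/(RPclass (plane_vec (c%:C * z))) plane_vecZ.
by rewrite RPclassZ// plane_vec_eq0.
Qed.

Lemma dir_twoarg z : z != 0 -> exists2 c, c != 0 & dir (twoarg z) = c%:C * z.
Proof.
move=> z0; have := @hcoord_RPclass R 1 (plane_vec z).
rewrite plane_vec_eq0 => /(_ z0)[c c0 hc]; exists c => //.
by apply: plane_vec_inj; rewrite plane_vec_dir plane_vecZ -hc.
Qed.

(** Affine coordinates are quotients of homogeneous ones, so they do not depend
    on the representative; division by zero causes no exception, as both sides
    are then zero. *)
Lemma chart_twoarg b z : z != 0 ->
  chart b (twoarg z) = if b then Re z / Im z else Im z / Re z.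
Proof.
move=> z0; have [c c0 zc] := dir_twoarg z0.
rewrite /chart -[hcoord _ ord0 ord0]/(Re (dir (twoarg z))).
rewrite -[hcoord _ ord0 ord_max]/(Im (dir (twoarg z))) zc.
by case: z {z0 zc} => x y /=; case: b; rewrite !mul0r subr0 addr0 -mulf_div divff// mul1r.
Qed.

Lemma chart_at_twoarg z : z != 0 -> chart_at (twoarg z) = (Re z == 0).
Proof.
move=> z0; have [c c0 zc] := dir_twoarg z0.
rewrite /chart_at -[hcoord _ ord0 ord0]/(Re (dir (twoarg z))) zc.
by case: z {z0 zc} => x y /=; rewrite mul0r subr0 mulf_eq0 (negbTE c0).
Qed.

(** The velocity of the argument of [z + t u] is [Im (u / z)], which is
    [Im (u z^* )] divided by [|z|^2].  The chart of RP^1 used at [z] only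
    changes it by another nonzero real factor. *)
Lemma dTwoArgE (z : 'rV[C]_4) : (forall i, z ord0 i != 0) ->
  exists2 kappa : 'I_4 -> R, forall i, kappa i != 0 &
    forall u i, dTwoArg z u ord0 i = kappa i * Im (u ord0 i * (z ord0 i)^*%C).
Proof.
move=> z0.
exists (fun i => if Re (z ord0 i) == 0 then - (Im (z ord0 i) ^+ 2)^-1
                 else (Re (z ord0 i) ^+ 2)^-1).
  move=> i; case: ifP => [/eqP Rz|/negbT Rz]; last by rewrite invr_eq0 sqrf_eq0.
  rewrite oppr_eq0 invr_eq0 sqrf_eq0; apply: contraNN (z0 i) => /eqP Iz.
  by apply/eqP; move: Rz Iz; case: (z ord0 i) => x y /= -> ->.
move=> u i; rewrite mxE chart_at_twoarg//.
have lineE (x y x' y' t : R) : (x +i* y + t%:C * (x' +i* y'))%C =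
    ((x + t * x') +i* (y + t * y'))%C.
  by rewrite /GRing.mul /= !mul0r subr0 addr0.
rewrite /TwoArg; move: (z0 i); under eq_fun do rewrite !mxE.
case: (z ord0 i) (u ord0 i) => x y [x' y'] zi0 /=.
case: ifP => [/eqP x0|/negbT x0].
  have y0 : y != 0 by apply: contraNneq zi0 => y0; rewrite x0 y0.
  rewrite (@derive1_affine_quotient _ _ x x' y y')//; last first.
    have := near_affine_neq0 y' y0; apply: filterS => t yt.
    rewrite lineE chart_twoarg//.
    by apply: contraNneq yt => -[_ ->].
  by rewrite x0; field.
rewrite (@derive1_affine_quotient _ _ y y' x x')//; last first.
  have := near_affine_neq0 x' x0; apply: filterS => t xt.
  rewrite lineE chart_twoarg//.
  by apply: contraNneq xt => -[-> _].
by field.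
Qed.

End TwoArg.

(** * Small index types *)

Local Notation i0 := (@ord0 3).
Local Notation i1 := (lift ord0 (@ord0 2)).
Local Notation i2 := (lift ord0 (lift ord0 (@ord0 1))).
Local Notation i3 := (lift ord0 (lift ord0 (lift ord0 (@ord0 0)))).
Local Notation j0 := (@ord0 2).
Local Notation j1 := (lift ord0 (@ord0 1)).
Local Notation j2 := (lift ord0 (lift ord0 (@ord0 0))).
Local Notation r0 := (@ord0 1).
Local Notation r1 := (lift ord0 (@ord0 0)).

Lemma sum3 (V : nmodType) (F : 'I_3 -> V) : \sum_i F i = F j0 + F j1 + F j2.
Proof. by rewrite !big_ord_recl big_ord0 addr0 !addrA. Qed.

Lemma ord3_ind (P : 'I_3 -> Prop) : P j0 -> P j1 -> P j2 -> forall i, P i.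
Proof.
move=> p0 p1 p2 [[|[|[|//]]] h].
- by rewrite (_ : Ordinal h = j0)//; exact/val_inj.
- by rewrite (_ : Ordinal h = j1)//; exact/val_inj.
- by rewrite (_ : Ordinal h = j2)//; exact/val_inj.
Qed.

Lemma sum4 (V : nmodType) (F : 'I_4 -> V) :
  \sum_i F i = F i0 + F i1 + F i2 + F i3.
Proof. by rewrite !big_ord_recl big_ord0 addr0 !addrA. Qed.

Lemma ord4_ind (P : 'I_4 -> Prop) : P i0 -> P i1 -> P i2 -> P i3 -> forall i, P i.
Proof.
move=> p0 p1 p2 p3 [[|[|[|[|//]]]] h].
- by rewrite (_ : Ordinal h = i0)//; exact/val_inj.
- by rewrite (_ : Ordinal h = i1)//; exact/val_inj.
- by rewrite (_ : Ordinal h = i2)//; exact/val_inj.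
- by rewrite (_ : Ordinal h = i3)//; exact/val_inj.
Qed.

Lemma third_index (i j : 'I_4) : i != j -> exists l, uniq [:: i; l; j].
Proof.
elim/ord4_ind: i; elim/ord4_ind: j => // _;
  solve [by exists i0|by exists i1|by exists i2|by exists i3].
Qed.

(** The last condition says that [i] is the fourth index, in a form suited to
    vectors vanishing at [i] and [a]. *)
Lemma other_indices (i : 'I_4) : exists a b c,
  uniq [:: a; b; c] /\ forall m, m != b -> m != c -> (m == i) || (m == a).
Proof.
elim/ord4_ind: i.
- by exists i1, i2, i3; split=> //; elim/ord4_ind.
- by exists i0, i2, i3; split=> //; elim/ord4_ind.
- by exists i0, i1, i3; split=> //; elim/ord4_ind.
- by exists i0, i1, i2; split=> //; elim/ord4_ind.
Qed.

(** * Critical values of a plane in normal form *)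

Lemma exists_nonroot (F : numFieldType) (p : {poly F}) :
  p != 0 -> exists x, p.[x] != 0.
Proof.
move=> p0; apply: contrapT => /forallNP pr.
pose rs : seq F := [seq i%:R | i <- iota 0 (size p)].
have := @max_poly_roots _ p rs p0; rewrite size_map size_iota ltnn => H.
apply/notF/H.
  by apply/allP => x _; apply/rootP/eqP; rewrite -[_ == _]negbK; apply/negP/pr.
by rewrite map_inj_uniq ?iota_uniq// => i j /eqP; rewrite eqr_nat => /eqP.
Qed.

(** A vector outside all the hyperplanes is found on the curve
    [x |-> (1, x, x^2, ...)]: along it each linear form is a nonzero polynomial
    in [x], and so is their product. *)
Lemma common_nonvanishing (F : numFieldType) (I : finType) (n : nat)
    (h : I -> 'I_n -> F) : (forall i, exists j, h i j != 0) ->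
  exists c : 'I_n -> F, forall i, \sum_j c j * h i j != 0.
Proof.
move=> hP; pose p i : {poly F} := \sum_j h i j *: 'X^j.
have p0 i : p i != 0.
  have [j hij] := hP i; apply: contraNneq hij => /(congr1 (fun q : {poly F} => q`_j)).
  rewrite coef0 coef_sum (bigD1 j)//= coefZ coefXn eqxx mulr1 big1 ?addr0 => [->//|l lj].
  by rewrite coefZ coefXn eq_sym (inj_eq val_inj) (negbTE lj) mulr0.
have [x] : exists x, (\prod_i p i).[x] != 0.
  by apply: exists_nonroot; apply/prodf_neq0 => i _.
rewrite horner_prod => /prodf_neq0 px; exists (fun j => x ^+ j) => i.
have := px i isT; rewrite horner_sum.
by under eq_bigr do rewrite hornerZ hornerXn mulrC.
Qed.

Section NormalForm.
Variable R : realType.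
Local Notation C := R[i].
Local Notation Re := (@complex.Re R).
Local Notation Im := (@complex.Im R).
Local Notation "x %:C" := (real_complex R x) (format "x %:C").

Lemma ImD (x y : C) : Im (x + y) = Im x + Im y.
Proof. by case: x y => a b []. Qed.

Lemma ImN (x : C) : Im (- x) = - Im x.
Proof. by case: x. Qed.

Lemma Im_sum (I : finType) (F : I -> C) : Im (\sum_i F i) = \sum_i Im (F i).
Proof. exact: (big_morph Im ImD). Qed.

Lemma ImZ c (x : C) : Im (c%:C * x) = c * Im x.
Proof. by case: x => a b /=; rewrite mul0r addr0. Qed.

Lemma Im_normsq (z : C) : Im (z * z^*%C) = 0.
Proof. by case: z => a b /=; ring. Qed.

Lemma Im_real_multiple c (z : C) : Im (c%:C * z^*%C * z) = 0.
Proof. by case: z => a b /=; ring. Qed.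

Lemma complex_eq0 (x : C) : Im x = 0 -> Im ('i%C * x) = 0 -> x = 0.
Proof.
case: x => a b /= ->; rewrite mul0r add0r mul1r => ->; exact: erefl.
Qed.

Lemma real_of_Im0 (x : C) : Im x = 0 -> x = (Re x)%:C.
Proof. by case: x => a b /= ->. Qed.

(** Both [x] and [y] are real multiples of [z^-1]. *)
Lemma parallel_real (x y z : C) : z != 0 -> Im (x * z) = 0 -> Im (y * z) = 0 ->
  Im (x * y^*%C) = 0.
Proof.
move=> z0 /real_of_Im0 xz /real_of_Im0 yz.
have conjM (a b : C) : (a * b)^*%C = a^*%C * b^*%C by rewrite rmorphM.
rewrite -[x](mulfK z0) -[y](mulfK z0) xz yz conjM conjc_real -mulrA ImZ.
by rewrite mulrCA ImZ Im_normsq !mulr0.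
Qed.

Variables (k w : 'I_4 -> C).
Hypothesis k_neq0 : forall i, k i != 0.
(* The imaginary part of [(x - z) * (y - z)^*] is twice the oriented area of
   the triangle x, y, z; the last hypothesis says that the cross-ratio of the
   four points is not real. *)
Hypothesis w_noncollinear : forall i j l, uniq [:: i; j; l] ->
  Im ((w i - w l) * (w j - w l)^*%C) != 0.
Hypothesis w_nonconcyclic :
  Im ((w i0 - w i1) * (w i2 - w i3) * ((w i0 - w i2) * (w i1 - w i3))^*%C) != 0.

Definition normal_plane : set 'rV[C]_4 :=
  [set z | \sum_i k i * z ord0 i = 0 /\ \sum_i k i * w i * z ord0 i = 1].

Definition normal_direction : set 'rV[C]_4 :=
  [set u | \sum_i k i * u ord0 i = 0 /\ \sum_i k i * w i * u ord0 i = 0].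

Lemma w_inj i j : i != j -> w i - w j != 0.
Proof.
move=> /third_index[l il].
by apply: contraNneq (w_noncollinear il) => ->; rewrite mul0r.
Qed.

Lemma direction_normal_plane z : normal_plane z ->
  direction normal_plane = normal_direction.
Proof.
move=> [z0 z1]; apply/seteqP; split=> u.
  move=> [x [y [[x0 x1] [y0 y1] ->]]]; split.
    under eq_bigr do rewrite !mxE mulrDr mulrN.
    by rewrite sumrB y0 x0 subr0.
  under eq_bigr do rewrite !mxE mulrDr mulrN.
  by rewrite sumrB y1 x1 subrr.
move=> [u0 u1]; exists z, (z + u); split=> //; last by rewrite addrC addKr.
split.
  by under eq_bigr do rewrite !mxE mulrDr; rewrite big_split /= z0 u0 addr0.
by under eq_bigr do rewrite !mxE mulrDr; rewrite big_split /= z1 u1 addr0.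
Qed.

(** A basis of the direction of the plane, built from the identity
    [(b - c) + (c - a) + (a - b) = 0] and its analogue with weights
    [a], [b], [c], applied to [w_0, w_1, w_2] and to [w_0, w_1, w_3]. *)
Definition dir_basis0 : 'rV[C]_4 := \row_m
  [:: (w i1 - w i2) / k i0; (w i2 - w i0) / k i1; (w i0 - w i1) / k i2; 0]`_m.
Definition dir_basis1 : 'rV[C]_4 := \row_m
  [:: (w i1 - w i3) / k i0; (w i3 - w i0) / k i1; 0; (w i0 - w i1) / k i3]`_m.

Lemma dir_basisP a b : normal_direction (a *: dir_basis0 + b *: dir_basis1).
Proof.
have [k0 k1 k2 k3] := And4 (k_neq0 i0) (k_neq0 i1) (k_neq0 i2) (k_neq0 i3).
by split; rewrite sum4 !mxE /=; field; rewrite k0 k1 k2 k3.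
Qed.

(** Orthogonality to the two basis vectors says that [mu_2 / k_2] and
    [mu_3 / k_3] are obtained by affine interpolation, as functions of [w],
    from [mu_0 / k_0] and [mu_1 / k_1]. *)
Lemma orthogonal_normal_direction (mu : 'I_4 -> C) :
  \sum_i mu i * dir_basis0 ord0 i = 0 -> \sum_i mu i * dir_basis1 ord0 i = 0 ->
  exists r t, forall i, mu i = k i * (t - w i * r).
Proof.
have [k0 k1 k2 k3] := And4 (k_neq0 i0) (k_neq0 i1) (k_neq0 i2) (k_neq0 i3).
have w01 : w i1 - w i0 != 0 by apply: w_inj.
pose m i := mu i / k i.
have muE i : mu i = k i * m i by rewrite /m mulrCA divff ?mulr1// k_neq0.
rewrite !sum4 !mxE /= !mulr0 addr0 => e0 e1.
pose r := (m i0 - m i1) / (w i1 - w i0).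
exists r, (m i0 + w i0 * r) => i; rewrite muE; congr (_ * _); move: i.
apply: ord4_ind.
- by rewrite addrK.
- by rewrite /r; field.
- apply/(mulIf w01)/eqP; rewrite -subr_eq0 -oppr_eq0; apply/eqP.
  by apply: etrans e0; rewrite /r /m; field; rewrite k0 k1 k2 w01.
- apply/(mulIf w01)/eqP; rewrite -subr_eq0 -oppr_eq0; apply/eqP.
  by apply: etrans e1; rewrite /r /m; field; rewrite k0 k1 k3 w01.
Qed.

(** A non-surjective differential is killed by some real covector [c].  By
    [dTwoArgE] the complex covector [mu_i = c_i kappa_i z_i^*] has zero
    imaginary part on the direction of the plane, which is a complex space, so
    [mu] itself vanishes there and has the form given by
    [orthogonal_normal_direction].  Evaluating [mu] at [z] gives [- r], and
    all the [mu_i z_i] are real, so [r] is real. *)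
Lemma critical_normal_plane z : critical_points normal_plane z ->
  exists (r : R) (t : C), ~ (r = 0 /\ t = 0) /\
    forall i, Im (z ord0 i * k i * (t - w i * r%:C)) = 0.
Proof.
move=> [[Vz z0]]; rewrite (direction_normal_plane Vz) => nsurj.
have [kappa kappa0 dE] := dTwoArgE z0.
(* Real coordinates on the direction of the plane. *)
pose v (y : 'rV[R]_4) : 'rV[C]_4 :=
  (y ord0 i0 +i* y ord0 i1)%C *: dir_basis0 + (y ord0 i2 +i* y ord0 i3)%C *: dir_basis1.
pose L : 'M[R]_4 := \matrix_m dTwoArg z (v (delta_mx 0 m)).
have vL y : dTwoArg z (v y) = y *m L.
  have LE m i : L m i = kappa i * Im ((v (delta_mx 0 m)) ord0 i * (z ord0 i)^*%C).
    by rewrite [LHS]mxE dE.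
  have vE y' i : (v y') ord0 i = (y' ord0 i0 +i* y' ord0 i1)%C * dir_basis0 ord0 i +
      (y' ord0 i2 +i* y' ord0 i3)%C * dir_basis1 ord0 i.
    by rewrite /v mxE; congr (_ + _); rewrite mxE.
  apply/rowP => i; rewrite dE vE [RHS]mxE sum4 !LE 4!vE.
  move: (dir_basis0 ord0 i) (dir_basis1 ord0 i) (z ord0 i) => [c d] [c' d'] [a b].
  by rewrite !mxE /=; ring.
have [LU|LnU] := boolP (L \in unitmx).
  exfalso; apply: nsurj => y _; exists (v (y *m invmx L)).
    exact: dir_basisP.
  by rewrite vL mulmxKV.
have /det0P[c c0 cL] : \det L^T == 0.
  by rewrite det_tr; move: LnU; rewrite unitmxE unitfE negbK.
have Lc : L *m c^T = 0 by rewrite -[L]trmxK -trmx_mul cL trmx0.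
pose mu i := (c ord0 i * kappa i)%:C * (z ord0 i)^*%C.
have mu0 a b : Im (\sum_i mu i * (a *: dir_basis0 + b *: dir_basis1) ord0 i) = 0.
  pose y : 'rV[R]_4 := \row_m [:: Re a; Im a; Re b; Im b]`_m.
  have -> : a *: dir_basis0 + b *: dir_basis1 = v y.
    by rewrite /v !mxE /=; case: (a) (b) => ? ? [].
  have : (dTwoArg z (v y) *m c^T) ord0 ord0 = 0 by rewrite vL -mulmxA Lc mulmx0 mxE.
  rewrite Im_sum mxE => {2}<-; apply: eq_bigr => i _.
  rewrite dE [c^T _ _]mxE /mu -[_ * (z _ _)^*%C * _]mulrA ImZ [(z _ _)^*%C * _]mulrC.
  by ring.
have [||r [t muE]] := @orthogonal_normal_direction mu.
- apply: complex_eq0.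
    by have := mu0 1 0; rewrite scale1r scale0r addr0.
  have E := mu0 'i%C 0; rewrite scale0r addr0 in E; rewrite -[RHS]E; congr (Im _).
  by rewrite mulr_sumr; apply: eq_bigr => i _; rewrite [in RHS]mxE mulrCA.
- apply: complex_eq0.
    by have := mu0 0 1; rewrite scale1r scale0r add0r.
  have E := mu0 0 'i%C; rewrite scale0r add0r in E; rewrite -[RHS]E; congr (Im _).
  by rewrite mulr_sumr; apply: eq_bigr => i _; rewrite [in RHS]mxE mulrCA.
have muz i : Im (mu i * z ord0 i) = 0 by rewrite /mu Im_real_multiple.
have rE : - r = \sum_i mu i * z ord0 i.
  have [z0' z1'] := Vz.
  transitivity (t * \sum_i k i * z ord0 i - r * \sum_i k i * w i * z ord0 i).
    by rewrite z0' z1' mulr0 sub0r mulr1.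
  rewrite !mulr_sumr -sumrB; apply: eq_bigr => i _; rewrite muE; ring.
have rR : r = (Re r)%:C.
  have : Im (- r) = 0 by rewrite rE Im_sum big1.
  by case: (r) => a b /= /eqP; rewrite oppr_eq0 => /eqP ->.
exists (Re r), t; split; last first.
  move=> i; rewrite -rR -mulrA -muE mulrC; exact: muz.
move=> [r0 t0]; move/eqP: c0; apply; apply/rowP => i; rewrite mxE.
have := muE i; rewrite t0 rR r0 mulr0 subr0 mulr0 /mu => /eqP.
rewrite mulf_eq0 conjc_eq0 (negbTE (z0 i)) orbF => /eqP[/eqP].
by rewrite mulf_eq0 (negbTE (kappa0 i)) orbF => /eqP.
Qed.

(** The points of the plane over a given product of real lines, the [i]-th line
    being spanned by [f_i / k_i], are the real solutions [x] of the equations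
    [\sum_i f_i x_i = 0] and [\sum_i w_i f_i x_i = 1]. *)
Section Fiber.
Variable f : 'I_4 -> C.
Hypothesis f_neq0 : forall i, f i != 0.

(** The homogeneous part: the second equation is only required up to a real
    factor, to be normalized at the end. *)
Definition real_solution (x : 'rV[R]_4) : Prop :=
  \sum_i f i * (x ord0 i)%:C = 0 /\ Im (\sum_i w i * f i * (x ord0 i)%:C) = 0.

Lemma real_solution_support2 x b c : real_solution x -> x != 0 -> b != c ->
  (forall m, m != b -> m != c -> x ord0 m = 0) -> Im ((w b - w c) * f c) = 0.
Proof.
move=> [x1 x2] x0 bc xS.
have sumE (g : 'I_4 -> C) : (forall m, x ord0 m = 0 -> g m = 0) ->
    \sum_m g m = g b + g c.
  move=> g0; rewrite (bigD1 b)//= (bigD1 c) 1?eq_sym//= big1 ?addr0// => m /andP[mb mc].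
  exact/g0/xS.
rewrite !sumE in x1 x2; try by move=> m ->; rewrite mulr0.
have xc : x ord0 c != 0.
  apply: contraNneq x0 => xc0; move: x1; rewrite xc0 mulr0 addr0 => /eqP.
  rewrite mulf_eq0 (negbTE (f_neq0 b)) orFb => /eqP[xb0].
  apply/eqP/rowP => m; rewrite mxE.
  by have [->//|mb] := eqVneq m b; have [->//|mc] := eqVneq m c; rewrite xS.
have : Im ((x ord0 c)%:C * ((w b - w c) * f c)) = 0.
  have fb : f b * (x ord0 b)%:C = - (f c * (x ord0 c)%:C) by apply/eqP; rewrite -addr_eq0 x1.
  move: x2; rewrite -mulrA fb => x2; rewrite -[RHS]oppr0 -[in RHS]x2.
  by rewrite -ImN; congr (Im _); ring.
by rewrite ImZ => /eqP; rewrite mulf_eq0 (negbTE xc) => /eqP.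
Qed.

(** If all the [v j] vanished at [i], two of them would be supported on pairs
    [{b, c}] and [{a, c}], which would make [w a - w c] and [w b - w c]
    parallel. *)
Lemma coordinate_nonvanishing (v : 'I_4 -> 'rV[R]_4) i :
  (forall j, [/\ real_solution (v j), v j != 0 & v j ord0 j = 0]) ->
  exists j, v j ord0 i != 0.
Proof.
move=> vP; apply: contrapT => /forallNP vi0.
have vi j : v j ord0 i = 0 by apply/eqP; apply: contrapT => /negP/vi0.
have [a [b [c [abc sup]]]] := other_indices i.
have /and3P[] := abc; rewrite !inE negb_or => /andP[ab ac] bc _.
have [va va0 vaa] := vP a; have [vb vb0 vbb] := vP b.
have bcf : Im ((w b - w c) * f c) = 0.
  apply: (real_solution_support2 va va0 bc) => m mb mc.
  by have /orP[/eqP->|/eqP->] := sup m mb mc.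
have acf : Im ((w a - w c) * f c) = 0.
  apply: (real_solution_support2 vb vb0 ac) => m ma mc.
  have [->//|mb] := eqVneq m b.
  by have := sup m mb mc; rewrite (negbTE ma) orbF => /eqP ->.
by move/eqP: (w_noncollinear abc); apply; exact: (parallel_real (f_neq0 c)).
Qed.

(** Otherwise the solutions supported on [{0, 1, 2}] and on [{1, 2, 3}] would
    satisfy two complex equations each.  These fix the ratios of their entries
    in terms of differences of the [w_i], and comparing the entries of index 1
    and 2 makes the cross-ratio of the [w_i] real. *)
Lemma moment_nonvanishing (v : 'I_4 -> 'rV[R]_4) :
  (forall j, [/\ real_solution (v j), v j != 0 & v j ord0 j = 0]) ->
  exists j, Re (\sum_i w i * f i * (v j ord0 i)%:C) != 0.
Proof.
move=> vP; apply: contrapT => /forallNP vrho.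
have moment0 j : \sum_i w i * f i * (v j ord0 i)%:C = 0.
  have [[_ im0] _ _] := vP j; have re0 : Re (\sum_i w i * f i * (v j ord0 i)%:C) = 0.
    by apply/eqP; apply: contrapT => /negP/vrho.
  by rewrite (real_of_Im0 im0) re0.
have [[+ _] + +] := vP i3; have [[+ _] + +] := vP i0.
have := moment0 i3; have := moment0 i0; rewrite !sum4.
move: (v i0) (v i3) => y x Y1 X1 Y0 yn0 y0 X0 xn0 x3.
rewrite y0 x3 !mulr0 !addr0 !add0r in X0 X1 Y0 Y1.
have XE : f i1 * (x ord0 i1)%:C * (w i0 - w i1) = - (f i2 * (x ord0 i2)%:C * (w i0 - w i2)).
  apply/eqP; rewrite -subr_eq0 opprK; apply/eqP.
  transitivity (w i0 * (f i0 * (x ord0 i0)%:C + f i1 * (x ord0 i1)%:C + f i2 * (x ord0 i2)%:C)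
    - (w i0 * f i0 * (x ord0 i0)%:C + w i1 * f i1 * (x ord0 i1)%:C + w i2 * f i2 * (x ord0 i2)%:C)).
    ring.
  by rewrite X0 X1 mulr0 subr0.
have YE : f i2 * (y ord0 i2)%:C * (w i2 - w i3) = - (f i1 * (y ord0 i1)%:C * (w i1 - w i3)).
  apply/eqP; rewrite -subr_eq0 opprK; apply/eqP.
  transitivity ((w i1 * f i1 * (y ord0 i1)%:C + w i2 * f i2 * (y ord0 i2)%:C +
      w i3 * f i3 * (y ord0 i3)%:C) -
    w i3 * (f i1 * (y ord0 i1)%:C + f i2 * (y ord0 i2)%:C + f i3 * (y ord0 i3)%:C)).
    ring.
  by rewrite Y0 Y1 mulr0 subr0.
have x1 : x ord0 i1 != 0.
  apply: contraNneq xn0 => x10; move/eqP: XE; rewrite x10 mulr0 mul0r eq_sym oppr_eq0.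
  rewrite !mulf_eq0 (negbTE (f_neq0 _)) (negbTE (w_inj _))//= orbF => /eqP[x20].
  move/eqP: X0; rewrite x10 x20 !mulr0 !addr0 mulf_eq0 (negbTE (f_neq0 _)) => /eqP[x00].
  by apply/eqP/rowP; apply: ord4_ind; rewrite mxE.
have y2 : y ord0 i2 != 0.
  apply: contraNneq yn0 => y20; move/eqP: YE; rewrite y20 mulr0 mul0r eq_sym oppr_eq0.
  rewrite !mulf_eq0 (negbTE (f_neq0 _)) (negbTE (w_inj _))//= orbF => /eqP[y10].
  move/eqP: Y0; rewrite y10 y20 !mulr0 !add0r mulf_eq0 (negbTE (f_neq0 _)) => /eqP[y30].
  by apply/eqP/rowP; apply: ord4_ind; rewrite mxE.
have E : (x ord0 i1 * y ord0 i2)%:C * ((w i0 - w i1) * (w i2 - w i3)) =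
         (x ord0 i2 * y ord0 i1)%:C * ((w i0 - w i2) * (w i1 - w i3)).
  apply: (mulfI (f_neq0 i1)); apply: (mulfI (f_neq0 i2)); rewrite !rmorphM /=.
  transitivity ((f i1 * (x ord0 i1)%:C * (w i0 - w i1)) *
                (f i2 * (y ord0 i2)%:C * (w i2 - w i3))); first by ring.
  by rewrite XE YE; ring.
move/eqP: w_nonconcyclic; apply; apply/eqP.
have : Im ((x ord0 i1 * y ord0 i2)%:C * ((w i0 - w i1) * (w i2 - w i3) *
    ((w i0 - w i2) * (w i1 - w i3))^*%C)) = 0.
  by rewrite mulrA E -mulrA ImZ Im_normsq mulr0.
by rewrite ImZ => /eqP; rewrite !mulf_eq0 (negbTE x1) (negbTE y2).
Qed.

(** The three real equations defining [real_solution] satisfy the linear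
    relation with coefficients [(Im t, Re t, - r)].  Hence they have rank at
    most two, and for each [j] there is a nonzero solution vanishing at [j].
    A generic combination of these four solutions has no zero coordinate and
    a nonzero moment, by which it is divided. *)
Lemma nonvanishing_solution (r : R) (t : C) : ~ (r = 0 /\ t = 0) ->
  (forall i, Im (f i * (t - w i * r%:C)) = 0) ->
  exists x : 'I_4 -> R, [/\ forall i, x i != 0, \sum_i f i * (x i)%:C = 0 &
    \sum_i w i * f i * (x i)%:C = 1].
Proof.
move=> rt0 fP.
have /choice[v vP] j : exists x : 'rV[R]_4,
    [/\ real_solution x, x != 0 & x ord0 j = 0].
  (* The three equations, and the condition that the coordinate j vanishes. *)
  pose N : 'M[R]_4 := \matrix_(i, m)
    [:: Re (f i); Im (f i); Im (w i * f i); (i == j)%:R]`_m.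
  pose c : 'rV[R]_4 := \row_m [:: Im t; Re t; - r; 0]`_m.
  have c0 : c != 0.
    apply/eqP => /rowP c0; apply: rt0.
    have := c0 i0; have := c0 i1; have := c0 i2; rewrite !mxE /= => /eqP.
    by rewrite oppr_eq0 => /eqP ->; case: (t) => a b /= -> ->.
  have cN : c *m N^T = 0.
    apply/rowP => i; rewrite !mxE sum4 !mxE /= -[RHS](fP i).
    by case: (f i) (w i) (t) => [a b] [a' b'] [a'' b''] /=; ring.
  have /det0P[x x0 xN] : \det N == 0.
    by rewrite -det_tr; apply/det0P; exists c.
  have xE m : \sum_i x ord0 i * N i m = 0.
    by have := congr1 (fun A : 'rV_4 => A ord0 m) xN; rewrite !mxE.
  exists x; split=> //.
    split; first (apply/eqP; rewrite eq_complex; apply/andP; split; apply/eqP).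
    - rewrite -[RHS](xE i0) (big_morph Re (id1 := 0) (op1 := +%R)); last 2 first.
      + by case=> ? ? [].
      + by [].
      by apply: eq_bigr => i _; rewrite !mxE /=; case: (f i) => a b /=; ring.
    - rewrite Im_sum -[RHS](xE i1); apply: eq_bigr => i _.
      by rewrite !mxE /=; case: (f i) => a b /=; ring.
    - rewrite Im_sum -[RHS](xE i2); apply: eq_bigr => i _.
      by rewrite !mxE /=; case: (w i * f i) => a b /=; ring.
  have := xE i3; rewrite (bigD1 j)//= big1 ?addr0 => [|i ij]; rewrite !mxE /=.
    by rewrite eqxx mulr1.
  by rewrite (negbTE ij) mulr0.
pose h (i : option 'I_4) j := if i is Some i then v j ord0 i
  else Re (\sum_i w i * f i * (v j ord0 i)%:C).
have [[i|]|c cP] := @common_nonvanishing R _ 4 h.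
- exact: coordinate_nonvanishing.
- exact: moment_nonvanishing.
pose y i := \sum_j c j * v j ord0 i.
pose rho := \sum_j c j * Re (\sum_i w i * f i * (v j ord0 i)%:C).
have rho0 : rho != 0 by exact: cP None.
have swap (g : 'I_4 -> C) : \sum_i g i * (y i)%:C =
    \sum_j (c j)%:C * \sum_i g i * (v j ord0 i)%:C.
  under [RHS]eq_bigr do rewrite mulr_sumr.
  rewrite exchange_big /=; apply: eq_bigr => i _.
  rewrite /y rmorph_sum mulr_sumr; apply: eq_bigr => j _.
  by rewrite rmorphM /= mulrCA.
exists (fun i => y i / rho); split.
- by move=> i; rewrite mulf_neq0 ?invr_eq0//; exact: (cP (Some i)).
- under eq_bigr do rewrite rmorphM /= mulrA.
  rewrite -mulr_suml swap big1 ?mul0r// => j _.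
  by have [[-> _] _ _] := vP j; rewrite mulr0.
- under eq_bigr do rewrite rmorphM /= mulrA.
  rewrite -mulr_suml swap.
  have -> : \sum_j (c j)%:C * (\sum_i w i * f i * (v j ord0 i)%:C) = rho%:C.
    rewrite /rho rmorph_sum /=; apply: eq_bigr => j _.
    have [[_ im0] _ _] := vP j.
    by rewrite rmorphM /= -(real_of_Im0 im0).
  by rewrite -rmorphM /= divff.
Qed.

End Fiber.

(** For the converse of [critical_normal_plane], the covector
    [mu_i = k_i (t - w_i r)] vanishes on the direction of the plane and has
    [mu_i z_i] real, so it gives a nontrivial real relation between the
    components of the differential at [z]. *)
Lemma critical_values_normal_plane (theta : {ptws 'I_4 -> RP R 1}) :
  critical_values normal_plane theta <-> exists (r : R) (t : C),
    ~ (r = 0 /\ t = 0) /\ forall i, Im (dir (theta i) * k i * (t - w i * r%:C)) = 0.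
Proof.
split.
  move=> [z zcrit <-]; have [r [t [rt0 zE]]] := critical_normal_plane zcrit.
  exists r, t; split=> // i; have [[_ z0] _] := zcrit.
  have [c _ ->] := dir_twoarg (z0 i).
  by rewrite -!mulrA ImZ mulrA zE mulr0.
move=> [r [t [rt0 thetaE]]]; pose f i := k i * dir (theta i).
have f0 i : f i != 0 by rewrite mulf_neq0// dir_neq0.
have [|x [x0 xk xw]] := @nonvanishing_solution f f0 r t rt0.
  by move=> i; rewrite /f [k i * _]mulrC.
pose z : 'rV[C]_4 := \row_i ((x i)%:C * dir (theta i)).
have zE i : z ord0 i = (x i)%:C * dir (theta i) by rewrite mxE.
have z0 i : z ord0 i != 0.
  rewrite zE mulf_neq0 ?dir_neq0//.
  by apply: contraNneq (x0 i) => xi0; rewrite -(inj_eq (@complexI R)) xi0.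
have Vz : normal_plane z.
  split; [rewrite -[RHS]xk|rewrite -[RHS]xw]; apply: eq_bigr => i _; rewrite zE /f; ring.
exists z; last by apply/funext => i; rewrite /TwoArg zE twoargZ ?dir_neq0// twoarg_dir.
split; first by split.
rewrite (direction_normal_plane Vz).
have [kappa kappa0 dE] := dTwoArgE z0.
pose mu i := k i * (t - w i * r%:C).
have [j muj] : exists j, mu j != 0.
  apply: contrapT => /forallNP mu0; apply: rt0.
  have m0 i : t - w i * r%:C = 0.
    by have /negP/negbNE := mu0 i; rewrite mulf_eq0 (negbTE (k_neq0 i)) => /eqP.
  have r0 : r = 0.
    apply: (@complexI R); apply: (mulfI (@w_inj i1 i0 isT)); rewrite mulr0.
    by rewrite -[RHS](subrr 0) -{1}(m0 i0) -(m0 i1); ring.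
  by split=> //; rewrite -[RHS](m0 i0) r0 mulr0 subr0.
move=> /(_ (delta_mx 0 j) I)[u [u0 u1] uj].
(* The relation has coefficients X i / (n i * kappa i), of which the j-th is
   nonzero, so the j-th unit vector is not a value of the differential. *)
have zmu i : mu i * z ord0 i = (Re (mu i * z ord0 i))%:C.
  apply: real_of_Im0; rewrite zE mulrCA ImZ.
  by have := thetaE i; rewrite -mulrA mulrC /mu => ->; rewrite mulr0.
pose X i := Re (mu i * z ord0 i).
pose n i := Re (z ord0 i * (z ord0 i)^*%C).
have nE i : (n i)%:C = z ord0 i * (z ord0 i)^*%C by rewrite -real_of_Im0// Im_normsq.
have n0 i : n i != 0.
  by rewrite -(inj_eq (@complexI R)) nE mulf_neq0// conjc_eq0.
have muu i : Im (mu i * u ord0 i) = X i / (n i * kappa i) * dTwoArg z u ord0 i.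
  rewrite dE; apply: (mulfI (n0 i)); rewrite -ImZ nE.
  transitivity (X i * Im (u ord0 i * (z ord0 i)^*%C)); last by field; rewrite n0 kappa0.
  by rewrite -ImZ /X -zmu; congr (Im _); ring.
have : \sum_i Im (mu i * u ord0 i) = 0.
  rewrite -Im_sum.
  transitivity (Im (t * \sum_i k i * u ord0 i - r%:C * \sum_i k i * w i * u ord0 i)).
    by congr (Im _); rewrite !mulr_sumr -sumrB; apply: eq_bigr => i _; rewrite /mu; ring.
  by rewrite u0 u1 !mulr0 subr0.
rewrite (bigD1 j)//= big1 ?addr0 => [|i ij]; rewrite muu uj mxE ?eqxx ?(negbTE ij) /= ?mulr0//.
move=> /eqP; rewrite mulr1 !mulf_eq0 invr_eq0 mulf_eq0 (negbTE (n0 j)) (negbTE (kappa0 j)) orbF.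
rewrite -(inj_eq (@complexI R)) /X -zmu mulf_eq0 (negbTE muj) (negbTE (z0 j)).
by [].
Qed.

End NormalForm.

(** * Pencils of lines in the projective plane *)

Section Incidence.
Variable R : realType.
Local Notation C := R[i].
Local Notation Re := (@complex.Re R).
Local Notation Im := (@complex.Im R).
Local Notation "x %:C" := (real_complex R x) (format "x %:C").

Lemma on_lineE (u v : 'rV[R]_3) : u != 0 -> v != 0 ->
  on_line (RPclass u) (RPclass v) = (u *m v^T == 0).
Proof.
move=> u0 v0; rewrite /on_line.
have [c c0 ->] := hcoord_RPclass u0; have [d d0 ->] := hcoord_RPclass v0.
by rewrite linearZ /= -scalemxAl -scalemxAr !scalemx_eq0 (negbTE c0) (negbTE d0).
Qed.

Lemma dot3_eq0 (u v : 'rV[R]_3) : (u *m v^T == 0) =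
  (u ord0 j0 * v ord0 j0 + u ord0 j1 * v ord0 j1 + u ord0 j2 * v ord0 j2 == 0).
Proof.
have -> : u ord0 j0 * v ord0 j0 + u ord0 j1 * v ord0 j1 + u ord0 j2 * v ord0 j2 =
    (u *m v^T) ord0 ord0 by rewrite mxE sum3 !mxE.
apply/eqP/eqP => [->|uv]; first by rewrite mxE.
by apply/matrixP => i j; rewrite !ord1 uv mxE.
Qed.

(** The plane of the [w_i] is the chart [r = 1] of the projective plane with
    homogeneous coordinates [(r, Re t, Im t)]. *)
Definition affine_point (z : C) : 'rV[R]_3 := \row_m [:: 1; Re z; Im z]`_m.

Lemma affine_point_neq0 z : affine_point z != 0.
Proof.
by apply/eqP => /rowP /(_ j0) /eqP; rewrite !mxE /= oner_eq0.
Qed.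

(** The coefficients of the linear form [Im (d (t - z r))] in the coordinates
    [(r, Re t, Im t)]. *)
Definition line_vec (z d : C) : 'rV[R]_3 := \row_m [:: - Im (d * z); Im d; Re d]`_m.

Lemma line_vec_neq0 z d : d != 0 -> line_vec z d != 0.
Proof.
apply: contraNneq => /rowP d0; have := d0 j1; have := d0 j2; rewrite !mxE /=.
by case: d {d0} => a b /= -> ->.
Qed.

Lemma line_vec_dot (u : 'rV[R]_3) z d : (u *m (line_vec z d)^T == 0) =
  (Im (d * ((u ord0 j1 +i* u ord0 j2)%C - z * (u ord0 j0)%:C)) == 0).
Proof.
rewrite dot3_eq0 !mxE /=; congr (_ == _); case: d z => a b [a' b'] /=; ring.
Qed.

Lemma line_vec_exists (v : 'rV[R]_3) z : v != 0 -> affine_point z *m v^T == 0 ->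
  exists2 d, d != 0 & v = line_vec z d.
Proof.
rewrite dot3_eq0 !mxE /= mul1r => v0 /eqP vz.
exists (v ord0 j2 +i* v ord0 j1)%C.
  apply: contraNneq v0 => -[v2 v1]; apply/eqP/rowP; apply: ord3_ind; rewrite mxE//.
  by move: vz; rewrite v1 v2 !mulr0 !addr0.
apply/rowP; apply: ord3_ind; rewrite !mxE //=.
apply/eqP; rewrite -subr_eq0 opprK; apply/eqP; rewrite -[RHS]vz.
by case: (z) => a b /=; ring.
Qed.

(** The factor [k] is the coefficient of a coordinate function in the first
    equation of the plane: it rotates the parametrization of the pencil. *)
Variables (z k : C).
Hypothesis k0 : k != 0.

Definition pencil (l : RP R 1) : RP R 2 := RPclass (line_vec z (dir l * k)).

Lemma pencilP l : on_line (RPclass (affine_point z)) (pencil l).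
Proof.
rewrite on_lineE ?affine_point_neq0 ?line_vec_neq0 ?mulf_neq0 ?dir_neq0//.
rewrite line_vec_dot !mxE /=; apply/eqP.
by case: (z) => a b; rewrite mulr1 subrr mulr0.
Qed.

Lemma on_pencil x l : on_line x (pencil l) =
  (Im (dir l * k * ((hcoord x ord0 j1 +i* hcoord x ord0 j2)%C
                     - z * (hcoord x ord0 j0)%:C)) == 0).
Proof.
rewrite -{1}(RPclass_hcoord x) on_lineE ?hcoord_neq0 ?line_vec_neq0//.
  by rewrite line_vec_dot.
by rewrite mulf_neq0 ?dir_neq0.
Qed.

Lemma pencil_inj : injective pencil.
Proof.
move=> l l' /RPclass_inj[||c c0 E].
- by rewrite line_vec_neq0 ?mulf_neq0 ?dir_neq0.
- by rewrite line_vec_neq0 ?mulf_neq0 ?dir_neq0.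
have dE : dir l = c%:C * dir l'.
  apply: (mulIf k0); rewrite -mulrA; move: (dir l * k) (dir l' * k) E => [a b] [a' b'] /rowP E.
  have := E j1; have := E j2; rewrite !mxE /= => -> ->.
  apply/eqP; rewrite eq_complex /=.
  by rewrite !mul0r subr0 addr0 !eqxx.
by rewrite -(twoarg_dir l) dE twoargZ ?twoarg_dir// dir_neq0.
Qed.

Lemma pencil_surj x : on_line (RPclass (affine_point z)) x -> exists l, pencil l = x.
Proof.
rewrite -{1}(RPclass_hcoord x) on_lineE ?affine_point_neq0 ?hcoord_neq0//.
move=> /(line_vec_exists (hcoord_neq0 x))[d d0 xd].
exists (twoarg (d / k)); have dk0 : d / k != 0 by rewrite mulf_neq0 ?invr_eq0.
have [c c0 cd] := dir_twoarg dk0.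
rewrite /pencil cd -mulrA divfK// -[RHS]RPclass_hcoord xd.
have -> : line_vec z (c%:C * d) = c *: line_vec z d.
  apply/rowP; apply: ord3_ind; rewrite !mxE /=; case: (d) (z) => a b [a' b'] /=; ring.
by rewrite RPclassZ// line_vec_neq0.
Qed.

(** The pencil is parametrized by an injective linear map from R^2 to R^3. *)
Lemma pencil_continuous : continuous pencil.
Proof.
pose L : 'M[R]_(2, 3) := \matrix_(i, m)
  (if i == ord0 then line_vec z k else line_vec z ('i%C * k)) ord0 m.
have LE l : line_vec z (dir l * k) = hcoord l *m L.
  apply/rowP => m; rewrite [RHS]mxE !big_ord_recl big_ord0 addr0 !mxE /=.
  rewrite /dir (_ : ord_max = lift ord0 ord0); last exact/val_inj.
  move: (hcoord l ord0 ord0) (hcoord l ord0 (lift ord0 ord0)) => a b.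
  by move: m; apply: ord3_ind => /=; case: (z) (k) => [c d] [c' d'] /=; ring.
have inj (v : 'rV[R]_2) : v != 0 -> v *m L != 0.
  move=> v0; have := @line_vec_neq0 z (dir (RPclass v) * k).
  rewrite mulf_neq0 ?dir_neq0// => /(_ isT); rewrite LE.
  have [c c0 ->] := hcoord_RPclass v0.
  by apply: contraNneq => vL; rewrite -scalemxAl vL scaler0.
have -> : pencil = fun l => RPclass (hcoord l *m L).
  by apply/funext => l; rewrite /pencil LE.
apply: (@RP_continuous R 1 (RP R 2) (fun v => RPclass (v *m L))) => [v v0|c v c0 v0].
  apply: (@continuous_comp _ _ _ (fun v : 'rV[R]_2 => v *m L) (@RPclass R 2)).
    rewrite (_ : (fun v : 'rV[R]_2 => v *m L) = fun v => \sum_i v ord0 i *: row i L).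
      by apply: sum_continuous_at => i; apply: continuousZl; exact: coord_continuous.
    by apply/funext => u; rewrite mulmx_sum_row.
  exact/RPclass_continuous/inj.
by rewrite -scalemxAl RPclassZ// inj.
Qed.

End Incidence.

(** * The critical values as a blow-up *)

Section BlowUpModel.
Variable R : realType.
Local Notation C := R[i].
Local Notation Re := (@complex.Re R).
Local Notation Im := (@complex.Im R).
Local Notation "x %:C" := (real_complex R x) (format "x %:C").

Variables (k w : 'I_4 -> C).
Hypothesis k_neq0 : forall i, k i != 0.
Hypothesis w_noncollinear : forall i j l, uniq [:: i; j; l] ->
  Im ((w i - w l) * (w j - w l)^*%C) != 0.
Hypothesis w_nonconcyclic :
  Im ((w i0 - w i1) * (w i2 - w i3) * ((w i0 - w i2) * (w i1 - w i3))^*%C) != 0.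

Definition center (i : 'I_4) : RP R 2 := RPclass (affine_point (w i)).

(** A common refinement of the blow-up and of the critical values: a point and
    four lines through it, each line being recorded by its parameter. *)
Definition incidence_graph : set (RP R 2 * {ptws 'I_4 -> RP R 1})%type :=
  [set xl | forall i, on_line xl.1 (pencil (w i) (k i) (xl.2 i))].

Definition to_lines (xl : RP R 2 * {ptws 'I_4 -> RP R 1}) :
    RP R 2 * {ptws 'I_4 -> RP R 2} :=
  (xl.1, fun i => pencil (w i) (k i) (xl.2 i)).

Lemma center_inj : injective center.
Proof.
move=> i j /RPclass_inj[||c c0 /rowP E]; try exact: affine_point_neq0.
have c1 : c = 1 by have := E j0; rewrite !mxE /= mulr1.
apply/eqP; apply: contrapT => /negP /(w_inj w_noncollinear) /eqP; apply.
have := E j1; have := E j2; rewrite !mxE /= c1 !mul1r.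
by case: (w i) (w j) => a b [a' b'] /= -> ->; rewrite subrr.
Qed.

Lemma pencil_eval_continuous i :
  continuous (fun xl : RP R 2 * {ptws 'I_4 -> RP R 1} => pencil (w i) (k i) (xl.2 i)).
Proof.
exact/snd_eval_continuous/pencil_continuous/k_neq0.
Qed.

Lemma incidence_graph_compact : compact incidence_graph.
Proof.
apply: (@subclosed_compact _ _ ([set: RP R 2] `*`
  [set f : {ptws 'I_4 -> RP R 1} | forall i, [set: RP R 1] (f i)])); last by [].
  rewrite (_ : incidence_graph = \bigcap_(i in [set: 'I_4])
      [set xl | on_line xl.1 (pencil (w i) (k i) (xl.2 i))]).
    apply: closed_bigI => i _; apply: incidence_closed.
      exact: fst_continuous.
    exact: pencil_eval_continuous.
  by apply/seteqP; split=> xl H i; [move=> _; exact: H|exact: (H i I)].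
apply: compact_setX; first exact: RP_compact.
apply: (@tychonoff 'I_4 (fun=> RP R 1) (fun=> [set: RP R 1])) => i.
exact: RP_compact.
Qed.

Lemma to_lines_continuous : continuous to_lines.
Proof.
exact: (@fiberwise_continuous (RP R 2) (RP R 1) (RP R 2) 'I_4
  (fun i => pencil (w i) (k i)) (fun i => pencil_continuous (k_neq0 i))).
Qed.

Lemma to_lines_image : to_lines @` incidence_graph = blowup center.
Proof.
apply/seteqP; split.
  move=> _ [xl Hxl <-] i /=; rewrite pencilP// Hxl//.
move=> [x l] H; have /choice[theta thetaE] i : exists t, pencil (w i) (k i) t = l i.
  by apply: pencil_surj => //; have /andP[] := H i.
exists (x, theta : {ptws 'I_4 -> RP R 1}).
  by move=> i /=; rewrite thetaE; have /andP[] := H i.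
rewrite /to_lines /=; congr pair; apply/funext => i; exact: thetaE.
Qed.

Lemma to_lines_inj : injective to_lines.
Proof.
move=> [x theta] [x' theta'] [-> E]; congr pair; apply/funext => i.
by have := congr1 (@^~ i) E; exact: pencil_inj.
Qed.

Lemma snd_image : snd @` incidence_graph = critical_values (normal_plane k w).
Proof.
apply/seteqP; split.
  move=> _ [[x theta] H <-].
  apply/(critical_values_normal_plane k_neq0 w_noncollinear w_nonconcyclic).
  exists (hcoord x ord0 j0), (hcoord x ord0 j1 +i* hcoord x ord0 j2)%C; split.
    move=> [x0 [x1 x2]]; have /eqP := hcoord_neq0 x; apply.
    by apply/rowP; apply: ord3_ind; rewrite mxE.
  by move=> i; apply/eqP; rewrite -on_pencil//; exact: H.
move=> theta /(critical_values_normal_plane k_neq0 w_noncollinear w_nonconcyclic).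
move=> [r [t [rt0 H]]].
pose v : 'rV[R]_3 := \row_m [:: r; Re t; Im t]`_m.
have v0 : v != 0.
  apply/eqP => /rowP v0; apply: rt0; have := v0 j0; have := v0 j1; have := v0 j2.
  by rewrite !mxE /=; case: (t) => a b /= -> -> ->.
exists (RPclass v, theta) => //= i.
have d0 : line_vec (w i) (dir (theta i) * k i) != 0.
  by rewrite line_vec_neq0 ?mulf_neq0 ?dir_neq0.
rewrite /pencil on_lineE// line_vec_dot !mxE /=; apply/eqP.
by rewrite -[RHS](H i); case: (t).
Qed.

(** If [x] and [x'], with coordinates [(r, t)] and [(r', t')], lie on the same
    four lines, then [t - w_i r] and [t' - w_i r'] are parallel for each [i].
    This is the equation [Im (t t'^* ) = Im (w_i s^* )], affine in [w_i], with
    [s = r t' - r' t].  As the [w_i] are not collinear, [s = 0], and the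
    coordinates are proportional. *)
Lemma snd_inj : {in incidence_graph &, injective snd}.
Proof.
move=> [x theta] [x' theta'] /set_mem H /set_mem H' /= E; subst theta'.
congr pair; apply: RP_eq_minors.
pose r (y : RP R 2) := hcoord y ord0 j0.
pose t (y : RP R 2) := (hcoord y ord0 j1 +i* hcoord y ord0 j2)%C.
have par i : Im ((t x - w i * (r x)%:C) * (t x' - w i * (r x')%:C)^*%C) = 0.
  have d0 : dir (theta i) * k i != 0 by rewrite mulf_neq0 ?dir_neq0.
  have P y : on_line y (pencil (w i) (k i) (theta i)) ->
      Im ((t y - w i * (r y)%:C) * (dir (theta i) * k i)) = 0.
    by rewrite (on_pencil _ (k_neq0 i)) mulrC => /eqP.
  by apply: (parallel_real d0); apply: P; [exact: H|exact: H'].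
pose s := (r x)%:C * t x' - (r x')%:C * t x.
have parE i : Im (t x * (t x')^*%C) = Im (w i * s^*%C).
  apply/eqP; rewrite -subr_eq0 -[X in _ == X](par i); apply/eqP.
  by rewrite /s; case: (t x) (t x') (w i) => [a b] [a' b'] [c d] /=; ring.
have s0 : s = 0.
  apply: contrapT => /eqP s0; move/eqP: (@w_noncollinear i0 i1 i2 isT); apply.
  apply: (@parallel_real _ _ _ s^*%C); first by rewrite conjc_eq0.
    by rewrite mulrBl ImD ImN -!parE subrr.
  by rewrite mulrBl ImD ImN -!parE subrr.
have := parE i0; rewrite s0 conjc0 mulr0 /= => t0.
move/eqP: s0; rewrite /s /t /r eq_complex /= => /andP[/eqP s1 /eqP s2].
apply: ord3_ind; apply: ord3_ind => //; lra.
Qed.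


Theorem critical_values_normal_plane_homeomorphic :
  is_RP2_blown_up_at R 4 (set_type (critical_values (normal_plane k w))).
Proof.
exists center; split; first exact: center_inj.
apply: homeomorphic_trans (_ : homeomorphic _ (set_type incidence_graph)) _.
  apply: homeomorphic_sym; rewrite -snd_image.
  apply: compact_image_homeomorphic.
  - by apply: (@hausdorff_product _ (fun=> RP R 1)) => _; exact: RP_hausdorff.
  - exact: incidence_graph_compact.
  - exact: snd_continuous.
  - exact: snd_inj.
rewrite -to_lines_image; apply: compact_image_homeomorphic.
- apply: hausdorff_prod; first exact: RP_hausdorff.
  by apply: (@hausdorff_product _ (fun=> RP R 2)) => _; exact: RP_hausdorff.
- exact: incidence_graph_compact.
- exact: to_lines_continuous.
- by move=> ? ? _ _; exact: to_lines_inj.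
Qed.

End BlowUpModel.

(** * Normal forms of generic planes *)

Import (canonicals) mpoly.

Section RealPolynomial.
Variables (R : realType) (n : nat) (T : Type) (v : T -> 'I_n -> R).
Local Notation C := R[i].

(** Complex functions of [x] that are polynomial in the real coordinates
    [v x]. *)
Definition real_polynomial (F : T -> C) : Prop := exists p q : mpoly.mpoly n R,
  forall x, F x = (mpoly.meval (v x) p +i* mpoly.meval (v x) q)%C.

Lemma real_polynomial_cst c : real_polynomial (fun=> c).
Proof.
exists (mpoly.mpolyC n (complex.Re c)), (mpoly.mpolyC n (complex.Im c)) => x.
by rewrite !mpoly.mevalC; case: c.
Qed.

Lemma real_polynomialD F G : real_polynomial F -> real_polynomial G ->
  real_polynomial (fun x => F x + G x).
Proof.
move=> [p [q FE]] [p' [q' GE]]; exists (p + p'), (q + q') => x.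
by rewrite FE GE !mpoly.mevalD.
Qed.

Lemma real_polynomialN F : real_polynomial F -> real_polynomial (fun x => - F x).
Proof. by move=> [p [q FE]]; exists (- p), (- q) => x; rewrite FE !mpoly.mevalN. Qed.

Lemma real_polynomialM F G : real_polynomial F -> real_polynomial G ->
  real_polynomial (fun x => F x * G x).
Proof.
move=> [p [q FE]] [p' [q' GE]]; exists (p * p' - q * q'), (p * q' + q * p') => x.
by rewrite FE GE mpoly.mevalB mpoly.mevalD !mpoly.mevalM.
Qed.

Lemma real_polynomial_conj F : real_polynomial F -> real_polynomial (fun x => (F x)^*%C).
Proof. by move=> [p [q FE]]; exists p, (- q) => x; rewrite FE mpoly.mevalN. Qed.

Lemma real_polynomial_sum (I : Type) (s : seq I) (P : pred I) (F : I -> T -> C) :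
  (forall i, real_polynomial (F i)) ->
  real_polynomial (fun x => \sum_(i <- s | P i) F i x).
Proof.
move=> FP; elim: s => [|i s [p [q IH]]].
  by have [p [q E]] := real_polynomial_cst 0; exists p, q => x; rewrite big_nil; exact: E.
have [Pi|nPi] := boolP (P i).
  have [p' [q' E]] : real_polynomial (fun x => F i x + \sum_(j <- s | P j) F j x).
    by apply: real_polynomialD => //; exists p, q.
  by exists p', q' => x; rewrite big_cons Pi; exact: E.
by exists p, q => x; rewrite big_cons (negbTE nPi) IH.
Qed.

Lemma real_polynomial_prod (I : Type) (s : seq I) (P : pred I) (F : I -> T -> C) :
  (forall i, real_polynomial (F i)) ->
  real_polynomial (fun x => \prod_(i <- s | P i) F i x).
Proof.
move=> FP; elim: s => [|i s [p [q IH]]].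
  by have [p [q E]] := real_polynomial_cst 1; exists p, q => x; rewrite big_nil; exact: E.
have [Pi|nPi] := boolP (P i).
  have [p' [q' E]] : real_polynomial (fun x => F i x * \prod_(j <- s | P j) F j x).
    by apply: real_polynomialM => //; exists p, q.
  by exists p', q' => x; rewrite big_cons Pi; exact: E.
by exists p, q => x; rewrite big_cons (negbTE nPi) IH.
Qed.

End RealPolynomial.

Section Genericity.
Variable R : realType.
Local Notation C := R[i].
Local Notation Re := (@complex.Re R).
Local Notation Im := (@complex.Im R).
Local Notation "x %:C" := (real_complex R x) (format "x %:C").
Implicit Types (a : 'rV[C]_4) (M : 'M[C]_(2, 4)).

Definition minor M i j : C := M r0 i * M r1 j - M r0 j * M r1 i.

(** The signed 3 by 3 minors of the matrix with rows [a] and [M]: they give the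
    linear form vanishing on the whole plane. *)
Definition coefk a M (i : 'I_4) : C :=
  [:: a ord0 i1 * minor M i2 i3 - a ord0 i2 * minor M i1 i3 + a ord0 i3 * minor M i1 i2;
      - (a ord0 i0 * minor M i2 i3 - a ord0 i2 * minor M i0 i3 + a ord0 i3 * minor M i0 i2);
      a ord0 i0 * minor M i1 i3 - a ord0 i1 * minor M i0 i3 + a ord0 i3 * minor M i0 i1;
      - (a ord0 i0 * minor M i1 i2 - a ord0 i1 * minor M i0 i2 + a ord0 i2 * minor M i0 i1)]`_i.

(** The signed minors of [M] for the columns 0, 2 and 3: they give a linear form
    constant on the plane and without second coordinate, whose value is
    [- coefk a M 1] by [coefq_affine]. *)
Definition coefq M (i : 'I_4) : C :=
  [:: minor M i2 i3; 0; - minor M i0 i3; minor M i0 i2]`_i.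

(** Up to nonzero factors, [w_i - w_j] for [w_i] proportional to
    [coefq M i / coefk a M i] (see [coefwB]). *)
Definition cross a M i j : C := coefq M i * coefk a M j - coefq M j * coefk a M i.

(** [(w_i - w_l) (w_j - w_l)^*] up to a positive real factor. *)
Definition triple a M i j l : C :=
  cross a M i l * (coefk a M i)^*%C * (cross a M j l)^*%C * coefk a M j.

(** The cross-ratio of the [w_i] up to a positive real factor. *)
Definition quadruple a M : C :=
  cross a M i0 i1 * cross a M i2 i3 * (cross a M i0 i2 * cross a M i1 i3)^*%C.

(** Its factors express that the [k_i] are nonzero, that no three of the [w_i]
    are collinear, and that their cross-ratio is not real; [z - z^*] stands for
    the imaginary part of [z]. *)
Definition discriminant a M : C :=
  \prod_i coefk a M i *
  (\prod_i \prod_j \prod_(l | uniq [:: i; j; l]) (triple a M i j l - (triple a M i j l)^*%C)) *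
  (quadruple a M - (quadruple a M)^*%C).

Lemma discriminant_polynomial n (T : Type) (v : T -> 'I_n -> R)
    (a : T -> 'rV[C]_4) (M : T -> 'M[C]_(2, 4)) :
  (forall i, real_polynomial v (fun x => a x ord0 i)) ->
  (forall i j, real_polynomial v (fun x => M x i j)) ->
  real_polynomial v (fun x => discriminant (a x) (M x)).
Proof.
move=> Pa PM.
have Pm i j : real_polynomial v (fun x => minor (M x) i j).
  apply: real_polynomialD; first exact: real_polynomialM.
  exact/real_polynomialN/real_polynomialM.
have Pk i : real_polynomial v (fun x => coefk (a x) (M x) i).
  have PB F G : real_polynomial v F -> real_polynomial v G ->
      real_polynomial v (fun x => F x - G x).
    by move=> ? ?; apply: real_polynomialD => //; exact: real_polynomialN.
  have Pam i' j l : real_polynomial v (fun x => a x ord0 i' * minor (M x) j l).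
    exact: real_polynomialM.
  elim/ord4_ind: i; rewrite /coefk /=; try apply: real_polynomialN;
    by apply: real_polynomialD; first exact: PB.
have Pq i : real_polynomial v (fun x => coefq (M x) i).
  elim/ord4_ind: i; rewrite /coefq /= //; first exact: real_polynomial_cst.
  exact: real_polynomialN.
have Pc i j : real_polynomial v (fun x => cross (a x) (M x) i j).
  apply: real_polynomialD; first exact: real_polynomialM.
  exact/real_polynomialN/real_polynomialM.
have PIm F : real_polynomial v F -> real_polynomial v (fun x => F x - (F x)^*%C).
  by move=> ?; apply: real_polynomialD => //; exact/real_polynomialN/real_polynomial_conj.
have Pt i j l : real_polynomial v (fun x => triple (a x) (M x) i j l).
  apply: real_polynomialM => //; apply: real_polynomialM; last exact: real_polynomial_conj.
  by apply: real_polynomialM => //; exact: real_polynomial_conj.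
apply: real_polynomialM; first apply: real_polynomialM.
- exact: real_polynomial_prod.
- apply: real_polynomial_prod => i; apply: real_polynomial_prod => j.
  by apply: real_polynomial_prod => l; apply: PIm.
- apply: PIm; apply: real_polynomialM; first exact: real_polynomialM.
  exact/real_polynomial_conj/real_polynomialM.
Qed.

Lemma coefk_affine a M (s : 'rV[C]_2) :
  \sum_i coefk a M i * (a + s *m M) ord0 i = 0.
Proof.
rewrite sum4 /coefk /minor /= !mxE !big_ord_recl !big_ord0 /=.
by ring.
Qed.

Lemma coefq_affine a M (s : 'rV[C]_2) :
  \sum_i coefq M i * (a + s *m M) ord0 i = - coefk a M i1.
Proof.
rewrite sum4 /coefk /coefq /minor /= !mxE !big_ord_recl !big_ord0 /=.
by ring.
Qed.

Section NonzeroDiscriminant.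
Variables (a : 'rV[C]_4) (M : 'M[C]_(2, 4)).
Hypothesis freeM : row_free M.
Hypothesis disc0 : discriminant a M != 0.

Definition coefw i : C := - coefq M i / (coefk a M i * coefk a M i1).

Lemma discriminant_factors : [/\ \prod_i coefk a M i != 0,
  \prod_i \prod_j \prod_(l | uniq [:: i; j; l])
    (triple a M i j l - (triple a M i j l)^*%C) != 0 &
  quadruple a M - (quadruple a M)^*%C != 0].
Proof.
have := disc0; rewrite /discriminant mulf_eq0 negb_or => /andP[+ ->].
by rewrite mulf_eq0 negb_or => /andP[-> ->].
Qed.

Lemma coefk_neq0 i : coefk a M i != 0.
Proof.
by have [/prodf_neq0 k0 _ _] := discriminant_factors; exact: k0.
Qed.

Lemma coefwB i j : coefw i - coefw j =
  - cross a M i j / (coefk a M i * coefk a M j * coefk a M i1).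
Proof.
rewrite /coefw /cross; move: (coefk a M) coefk_neq0 (coefq M) => k k0 q.
by field; rewrite !k0.
Qed.

Lemma sub_conj_neq0 (z : C) : z - z^*%C != 0 -> Im z != 0.
Proof.
apply: contraNneq; case: z => x y /= ->.
by rewrite eq_complex /= subrr oppr0 subrr eqxx.
Qed.

Definition normsq (z : C) : R := Re (z * z^*%C).

Lemma normsqE (z : C) : z * z^*%C = (normsq z)%:C.
Proof. by rewrite -real_of_Im0// Im_normsq. Qed.

Lemma coefw_noncollinear i j l : uniq [:: i; j; l] ->
  Im ((coefw i - coefw l) * (coefw j - coefw l)^*%C) != 0.
Proof.
move=> ijl; have : Im (triple a M i j l) != 0.
  have [_ /prodf_neq0/(_ i isT)/prodf_neq0/(_ j isT)/prodf_neq0 H _] := discriminant_factors.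
  exact/sub_conj_neq0/H.
have -> : triple a M i j l =
    ((coefk a M i * (coefk a M i)^*%C) * (coefk a M j * (coefk a M j)^*%C) *
     (coefk a M l * (coefk a M l)^*%C) * (coefk a M i1 * (coefk a M i1)^*%C)) *
    ((coefw i - coefw l) * (coefw j - coefw l)^*%C).
  rewrite !coefwB /triple; move: (coefk a M) coefk_neq0 (cross a M) => k k0 c.
  rewrite rmorphM rmorphN fmorphV !rmorphM; field.
  by rewrite !conjc_eq0 !k0.
by apply: contraNneq => E; rewrite !normsqE -!rmorphM ImZ E mulr0.
Qed.

Lemma coefw_nonconcyclic :
  Im ((coefw i0 - coefw i1) * (coefw i2 - coefw i3) *
    ((coefw i0 - coefw i2) * (coefw i1 - coefw i3))^*%C) != 0.
Proof.
have : Im (quadruple a M) != 0.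
  by have [_ _ H] := discriminant_factors; exact: sub_conj_neq0.
have -> : quadruple a M =
    (\prod_(i : 'I_4) (coefk a M i * (coefk a M i)^*%C) *
     ((coefk a M i1 * (coefk a M i1)^*%C) * (coefk a M i1 * (coefk a M i1)^*%C))) *
  ((coefw i0 - coefw i1) * (coefw i2 - coefw i3) *
    ((coefw i0 - coefw i2) * (coefw i1 - coefw i3))^*%C).
  rewrite !coefwB /quadruple !big_ord_recl big_ord0.
  move: (coefk a M) coefk_neq0 (cross a M) => k k0 c.
  rewrite !rmorphM !rmorphN !fmorphV !rmorphM; field.
  by rewrite !conjc_eq0 !k0.
apply: contraNneq => E; under eq_bigr do rewrite normsqE.
by rewrite !normsqE -rmorph_prod -!rmorphM ImZ E mulr0.
Qed.

(** The inclusion from left to right is [coefk_affine] and [coefq_affine].  The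
    two linear forms are independent because [w_0] and [w_1] differ, so their
    common kernel has dimension two and is spanned by the rows of [M]. *)
Lemma plane_of_normal_plane : plane_of a M = normal_plane (coefk a M) coefw.
Proof.
have wE (z : 'rV[C]_4) : \sum_i coefk a M i * coefw i * z ord0 i =
    - (\sum_i coefq M i * z ord0 i) / coefk a M i1.
  rewrite -sumrN mulr_suml; apply: eq_bigr => i _; rewrite /coefw.
  by move: (coefk a M) coefk_neq0 => k k0; field; rewrite !k0.
have sub s : normal_plane (coefk a M) coefw (a + s *m M).
  split; first exact: coefk_affine.
  by rewrite wE coefq_affine opprK divff// coefk_neq0.
apply/seteqP; split=> [_ [s _ <-]|z [z0 z1]]; first exact: sub.
have [a0 a1] : normal_plane (coefk a M) coefw a.
  by have := sub 0; rewrite mul0mx addr0.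
pose N : 'M[C]_(4, 2) := \matrix_(i, j) if j == r0 then coefk a M i else coefq M i.
have q0 (y : 'rV[C]_4) : \sum_i coefk a M i * coefw i * y ord0 i = 1 ->
    \sum_i coefq M i * y ord0 i = - coefk a M i1.
  rewrite wE => E; apply: oppr_inj; rewrite opprK.
  by rewrite -[RHS]mul1r -E divfK// coefk_neq0.
have uN : (z - a) *m N = 0.
  apply/rowP => j; rewrite !mxE; case: (boolP (j == r0)) => jr.
    under eq_bigr do rewrite !mxE jr mulrC mulrBr.
    by rewrite sumrB z0 a0 subr0.
  under eq_bigr do rewrite !mxE (negbTE jr) mulrC mulrBr.
  by rewrite sumrB !q0// subrr.
have rowM i : row i M = (delta_mx 0 i : 'rV_2) *m M by rewrite rowE.
have kM i : \sum_l coefk a M l * M i l = 0.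
  have := coefk_affine a M (delta_mx 0 i); rewrite -rowM.
  under eq_bigr do rewrite !mxE mulrDr.
  by rewrite big_split /= a0 add0r.
have qM i : \sum_l coefq M l * M i l = 0.
  have := coefq_affine a M (delta_mx 0 i); rewrite -rowM.
  under eq_bigr do rewrite !mxE mulrDr.
  by rewrite big_split /= (q0 _ a1) => /eqP; rewrite addrC -subr_eq0 opprK addrK => /eqP.
have MN : M *m N = 0.
  apply/matrixP => i j; rewrite !mxE; case: (boolP (j == r0)) => jr.
    by under eq_bigr do rewrite !mxE jr mulrC; exact: kM.
  by under eq_bigr do rewrite !mxE (negbTE jr) mulrC; exact: qM.
have rankN : \rank N = 2%N.
  rewrite -mxrank_tr; apply/eqP; apply: inj_row_free => y yN.
  have y01 i : y ord0 r0 * coefk a M i + y ord0 r1 * coefq M i = 0.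
    have := congr1 (fun A : 'rV[C]_4 => A ord0 i) yN.
    by rewrite !mxE !big_ord_recl big_ord0 addr0 !mxE.
  have c01 : cross a M i0 i1 != 0.
    have := @w_inj R coefw coefw_noncollinear i0 i1 isT.
    by rewrite coefwB; apply: contraNneq => ->; rewrite oppr0 mul0r.
  have [e0 e1] : y ord0 r0 * cross a M i0 i1 = 0 /\ y ord0 r1 * cross a M i0 i1 = 0.
    rewrite /cross; move: (coefk a M) (coefq M) y01 => k q y01; split.
      transitivity (q i0 * (y ord0 r0 * k i1 + y ord0 r1 * q i1) -
                    q i1 * (y ord0 r0 * k i0 + y ord0 r1 * q i0)); first by ring.
      by rewrite !y01 !mulr0 subr0.
    transitivity (k i1 * (y ord0 r0 * k i0 + y ord0 r1 * q i0) -
                  k i0 * (y ord0 r0 * k i1 + y ord0 r1 * q i1)); first by ring.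
    by rewrite !y01 !mulr0 subr0.
  apply/rowP => j; rewrite mxE; apply: (mulIf c01); rewrite mul0r.
  case: j => [[|[|//]]] h.
    by rewrite -[RHS]e0; congr (y _ _ * _); exact/val_inj.
  by rewrite -[RHS]e1; congr (y _ _ * _); exact/val_inj.
have kerM : (kermx N <= M)%MS.
  have MK : (M <= kermx N)%MS by exact/sub_kermxP.
  by rewrite -(mxrank_leqif_sup MK) mxrank_ker rankN (eqP freeM).
have /submxP[s sE] : (z - a <= M)%MS.
  by apply: submx_trans kerM; exact/sub_kermxP.
by exists s => //; rewrite -sE addrC subrK.
Qed.

End NonzeroDiscriminant.

End Genericity.

Section DegeneratePlanes.
Variable R : realType.
Local Notation C := R[i].
Local Notation Re := (@complex.Re R).
Local Notation Im := (@complex.Im R).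
Implicit Types (a : 'rV[C]_4) (M : 'M[C]_(2, 4)).

(** Quantifying over all parametrizations makes the set independent of the
    chosen one, with no need to know how the discriminant transforms. *)
Definition degenerate : set (set 'rV[C]_4) :=
  [set V | affine_plane V /\
    forall a M, row_free M -> V = plane_of a M -> discriminant a M = 0].

Lemma plane_of_reparam a M (g : 'M[C]_2) (s : 'rV[C]_2) : g \in unitmx ->
  plane_of (a + s *m M) (g *m M) = plane_of a M.
Proof.
move=> gU; apply/seteqP; split=> _ [t _ <-].
  by exists (s + t *m g) => //; rewrite mulmxDl addrA mulmxA.
exists ((t - s) *m invmx g) => //.
by rewrite mulmxA mulmxKV// mulmxBl -addrA [_ + (_ - _)]addrC subrK.
Qed.

Lemma plane_of_eq a M a' M' : row_free M' -> plane_of a M = plane_of a' M' ->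
  exists g s, [/\ g \in unitmx, a' = a + s *m M & M' = g *m M].
Proof.
move=> free' E.
have [s _ sE] : plane_of a M a' by rewrite E; exists 0 => //; rewrite mul0mx addr0.
have /submxP[g gE] : (M' <= M)%MS.
  apply/row_subP => i; rewrite rowE.
  have [t _ tE] : plane_of a M (a' + delta_mx 0 i *m M') by rewrite E; exists (delta_mx 0 i).
  apply/submxP; exists (t - s); rewrite mulmxBl; apply: (addrI a').
  by rewrite -tE -sE -addrA [_ + (_ - _)]addrC subrK.
exists g, s; split=> //; rewrite -row_free_unit.
by rewrite -row_leq_rank -{1}(eqP free') gE mxrankM_maxl.
Qed.

Definition plane_coords (x : 'rV[C]_4 * 'M[C]_(2, 4)) (k : 'I_(3 * 4 + 3 * 4)) : R :=
  real_coords (col_mx x.1 x.2) ord0 k.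

Lemma real_polynomial_entry i j : real_polynomial plane_coords
  (fun x => (col_mx x.1 x.2 : 'M[C]_(1 + 2, 4)) i j).
Proof.
exists (mpoly.mpolyX R (mpoly.mnm1 (lshift (3 * 4) (mxvec_index i j)))).
exists (mpoly.mpolyX R (mpoly.mnm1 (rshift (3 * 4) (mxvec_index i j)))) => x.
rewrite !mpoly.mevalXU /plane_coords /real_coords row_mxEl row_mxEr !mxvecE.
by rewrite ![map_mx _ _ _ _]mxE; case: (col_mx _ _ _ _).
Qed.

Lemma real_polynomial_reparam (g : 'M[C]_2) (s : 'rV[C]_2) :
  real_polynomial plane_coords
    (fun x => discriminant (x.1 + s *m x.2) (g *m x.2)).
Proof.
have P1 j : real_polynomial plane_coords (fun x => x.1 ord0 j).
  have [p [q E]] := real_polynomial_entry (lshift 2 ord0) j.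
  by exists p, q => x; rewrite -E col_mxEu.
have P2 i j : real_polynomial plane_coords (fun x => x.2 i j).
  have [p [q E]] := real_polynomial_entry (rshift 1 i) j.
  by exists p, q => x; rewrite -E col_mxEd.
have PM m (A : 'M[C]_(m, 2)) i j :
    real_polynomial plane_coords (fun x => (A *m x.2) i j).
  have [p [q E]] : real_polynomial plane_coords (fun x => \sum_l A i l * x.2 l j).
    by apply: real_polynomial_sum => l; apply: real_polynomialM => //; exact: real_polynomial_cst.
  by exists p, q => x; rewrite -E mxE.
apply: discriminant_polynomial => // i.
have [p [q E]] := real_polynomialD (P1 i) (PM _ s ord0 i).
by exists p, q => x; rewrite -E mxE.
Qed.

(** For a fixed reparametrization [(g, s)], the discriminant of the
    reparametrized pair is a complex polynomial in the coordinates of [(a, M)],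
    whose real and imaginary parts belong to the family of equations below.
    All parametrizations of a plane are obtained in this way. *)
Lemma degenerate_algebraic : real_algebraic degenerate.
Proof.
split; first by move=> V [].
exists [set p | exists g s, g \in unitmx /\ forall a M,
  discriminant (a + s *m M) (g *m M) = 0 ->
  mpoly.meval (plane_coords (a, M)) p = 0].
move=> a M freeM; split.
  move=> [_ disc0] p [g [s [gU]]]; apply; apply: disc0.
    by rewrite -row_leq_rank mxrankMfree// row_leq_rank row_free_unit.
  by rewrite plane_of_reparam.
move=> roots; split; first by exists a, M.
move=> a' M' free' E; have [g [s [gU -> ->]]] := plane_of_eq free' E.
have [p [q pqE]] := real_polynomial_reparam g s.
have p0 : mpoly.meval (plane_coords (a, M)) p = 0.
  apply: roots; exists g, s; split=> // b N.
  by have /= -> := pqE (b, N) => -[].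
have q0 : mpoly.meval (plane_coords (a, M)) q = 0.
  apply: roots; exists g, s; split=> // b N.
  by have /= -> := pqE (b, N) => -[].
by have /= -> := pqE (a, M); rewrite p0 q0.
Qed.

(** A plane for which the [k_i] are [-1], [-i], [1 + i], [-1 - 2 i] and the
    factors of the discriminant are small numbers. *)
Definition sample_point : 'rV[C]_4 := \row_j [:: 1; 'i%C; 0; 0]`_j.

Definition sample_basis : 'M[C]_(2, 4) := \matrix_(i, j)
  (if i == ord0 then [:: 1; 0; - 1 - 'i%C; - 1] else [:: 0; 1; - 1; - 1])`_j.

Lemma sample_basis_free : row_free sample_basis.
Proof.
apply: inj_row_free => y /rowP yM; apply/rowP => j; rewrite mxE.
have := yM i0; have := yM i1; rewrite !mxE !big_ord_recl !big_ord0 !mxE /=.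
rewrite !mulr0 !mulr1 !addr0 add0r => y1 y0.
by case: j => [[|[|//]]] h; [rewrite -[RHS]y0|rewrite -[RHS]y1]; congr (y _ _); exact/val_inj.
Qed.

Lemma sample_discriminant : discriminant sample_point sample_basis != 0.
Proof.
have kE i : coefk sample_point sample_basis i =
    [:: (-1 +i* 0)%C; (0 +i* -1)%C; (1 +i* 1)%C; (-1 +i* -2)%C]`_i.
  elim/ord4_ind: i; rewrite /coefk /minor !mxE /=; apply/eqP; rewrite eq_complex /=;
    apply/andP; split; apply/eqP; ring.
have qE i : coefq sample_basis i =
    [:: (0 +i* 1)%C; (0 +i* 0)%C; (1 +i* 0)%C; (-1 +i* 0)%C]`_i.
  elim/ord4_ind: i; rewrite /coefq /minor ?mxE /=; apply/eqP; rewrite eq_complex /=;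
    apply/andP; split; apply/eqP; ring.
have sub_conj (z : C) : Im z != 0 -> z - z^*%C != 0.
  case: z => x y /= y0; rewrite eq_complex /= negb_and opprK; apply/orP; right.
  by rewrite -mulr2n mulrn_eq0.
rewrite /discriminant !mulf_neq0//.
- apply/prodf_neq0 => i _; rewrite kE; elim/ord4_ind: i => /=;
  rewrite eq_complex /= negb_and; apply/orP;
  solve [by left; apply/eqP => ?; lra | by right; apply/eqP => ?; lra].
- apply/prodf_neq0 => i _; apply/prodf_neq0 => j _; apply/prodf_neq0 => l ijl.
  apply: sub_conj; rewrite /triple /cross !kE !qE; move: ijl.
  elim/ord4_ind: i; elim/ord4_ind: j; elim/ord4_ind: l => //= _; apply/eqP => ?; lra.
- apply: sub_conj; rewrite /quadruple /cross !kE !qE /=; apply/eqP => ?; lra.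
Qed.

Lemma degenerate_proper : degenerate `<` @affine_plane R.
Proof.
split; first by move=> V [].
move=> H.
have affS : affine_plane (plane_of sample_point sample_basis).
  by exists sample_point, sample_basis; split=> //; exact: sample_basis_free.
have [_ d0] := H _ affS; move/eqP: sample_discriminant; apply.
by apply: d0; first exact: sample_basis_free.
Qed.

End DegeneratePlanes.

Theorem theorem1 (R : realType) :
  exists E : set (set 'rV[R[i]]_4),
    [/\ real_algebraic E, E `<` @affine_plane R &
      forall V : set 'rV[R[i]]_4, affine_plane V -> ~ E V ->
        is_RP2_blown_up_at R 4 (set_type (critical_values V))].
Proof.
exists (@degenerate R); split.
- exact: degenerate_algebraic.
- exact: degenerate_proper.
move=> V affV nE.
have [a [M [freeM VE disc0]]] : exists a M,
    [/\ row_free M, V = plane_of a M & discriminant a M != 0].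
  apply: contrapT => noparam; apply: nE; split=> // a M freeM VE.
  by apply/eqP; apply: contrapT => /negP disc0; apply: noparam; exists a, M.
rewrite VE (plane_of_normal_plane freeM disc0).
apply: critical_values_normal_plane_homeomorphic.
- exact: coefk_neq0.
- exact: coefw_noncollinear.
- exact: coefw_nonconcyclic.
Qed.
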